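(* Let $\mathcal{N}$ be a pro-nilpotent Lie algebra and $\mathcal{T}$ a maximal torus on $\mathcal{N}$. Let $\mathcal{B}=\bigcup_{i\ge1}\mathcal{B}_i$ be a basis of $\mathcal{N}$ compatible with the lower central series in which $\mathcal{T}$ is simultaneously diagonal, and for each $k$ let $\mathcal{T}_k$ be the maximal torus of $\mathcal{W}_k=\mathcal{N}/\mathcal{N}^{k+1}$ in the basis (image of) $\bigcup_{i=1}^k\mathcal{B}_i$. Then $\lim_{k\to\infty}\mathcal{T}_k=\mathcal{T}$. Moreover, any two maximal tori on $\mathcal{N}$ have the same dimension.
   Context: All Lie algebras and vector spaces are over $\mathbb{C}$ and have a countable Hamel basis. For a Lie algebra $\mathcal{L}$ put $\mathcal{L}^1=\mathcal{L}$, $\mathcal{L}^{k+1}=[\mathcal{L}^k,\mathcal{L}]$. An infinite-dimensional Lie algebra $\mathcal{L}$ is pro-nilpotent if $\bigcap_{i\ge1}\mathcal{L}^i=0$ and $\dim(\mathcal{L}/\mathcal{L}^{i+1})<\infty$ for all $i\ge1$. A torus on a Lie algebra is a commutative subalgebra of its derivation algebra consisting of diagonalizable endomorphisms; it is maximal if not strictly contained in any other torus. A basis $\mathcal{B}=\bigcup_i\mathcal{B}_i$ of $\mathcal{N}$ is compatible with the lower central series if $\mathcal{B}_i\subset\mathcal{N}^i$ is a finite set mapping bijectively to a basis of $\mathcal{N}^i/\mathcal{N}^{i+1}$ for every $i$. A maximal torus of $\mathcal{W}_k$ in a given basis is a maximal torus of $\mathcal{W}_k$ consisting of derivations that are diagonal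 in that basis. The equality $\lim_{k\to\infty}\mathcal{T}_k=\mathcal{T}$ means: there is $k_0$ such that for all $k\ge k_0$ the torus $\mathcal{T}_{k+1}$ induces $\mathcal{T}_k$ via the natural projection $\mathcal{W}_{k+1}\to\mathcal{W}_k$, and $\mathcal{T}$ is the unique torus on $\mathcal{N}$ such that for every $k\ge k_0$ the set of derivations of $\mathcal{W}_k$ induced by the elements of $\mathcal{T}$ is $\mathcal{T}_k$.
   Formalization: The claim ''any two maximal tori have the same dimension'', false for arbitrary maximal tori, is stated for maximal tori that are each diagonal in a compatible basis in which every W_k (k ≥ 1) has a maximal torus T_k, as in the first part. *)

(* Defs.v *)
From HB Require Import structures.
From mathcomp Require Import all_boot all_order all_algebra.
From mathcomp Require Import complex.
From mathcomp Require Import all_classical all_reals.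

Set Implicit Arguments.
Unset Strict Implicit.
Unset Printing Implicit Defensive.

Import GRing.Theory.

Local Open Scope classical_set_scope.
Local Open Scope ring_scope.
Local Open Scope quotient_scope.

Section LinearAlgebra.
Context {K : fieldType} {V : lmodType K}.
Implicit Types (A B U : set V).

Definition lspan A : set V :=
  [set v | exists2 s : seq (K * V),
     (forall p, p \in s -> A p.2) & v = \sum_(p <- s) p.1 *: p.2].

Definition lin_indep A : Prop :=
  forall (s : seq V) (c : V -> K), uniq s -> (forall v, v \in s -> A v) ->
    \sum_(v <- s) c v *: v = 0 -> forall v, v \in s -> c v = 0.

Definition subspace U : Prop :=
  U 0 /\ forall (a : K) u v, U u -> U v -> U (a *: u + v).

Definition is_basis U B : Prop :=
  [/\ B `<=` U, lin_indep B & U `<=` lspan B].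

Lemma lspan_subspace A : subspace (lspan A).
Proof.
split; first by exists [::] => //; rewrite big_nil.
move=> a _ _ [s sA ->] [t tA ->].
exists ([seq (a * p.1, p.2) | p <- s] ++ t) => [p|].
  by rewrite mem_cat => /orP[/mapP[q /sA Aq ->]|/tA].
rewrite big_cat big_map scaler_sumr; congr (_ + _).
by apply: eq_bigr => p _; rewrite scalerA.
Qed.

Lemma sub_lspan A : A `<=` lspan A.
Proof.
move=> x Ax; exists [:: (1, x)] => [p|]; first by rewrite inE => /eqP ->.
by rewrite big_seq1 scale1r.
Qed.

Lemma lspan_min A U : subspace U -> A `<=` U -> lspan A `<=` U.
Proof.
move=> [U0 UP] AU _ [s + ->]; elim: s => [|p s IHs] sA; rewrite ?big_nil //.
rewrite big_cons; apply: UP; first by apply/AU/sA; rewrite mem_head.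
by apply: IHs => q qs; apply: sA; rewrite inE qs orbT.
Qed.

End LinearAlgebra.

Definition finite_dim (K : fieldType) (V : lmodType K) : Prop :=
  exists2 B : set V, is_basis setT B & finite_set B.

Definition countable_dim (K : fieldType) (V : lmodType K) : Prop :=
  exists2 B : set V, is_basis setT B & countable B.

Definition same_dim (K : fieldType) (V W : lmodType K)
    (U1 : set V) (U2 : set W) : Prop :=
  exists B1 B2, [/\ is_basis U1 B1, is_basis U2 B2 & (B1 #= B2)%card].

HB.mixin Record isLieAlgebra (K : fieldType) L of GRing.Lmodule K L := {
  lie : L -> L -> L;
  lie_linearl : forall (z : L) (a : K) (x y : L),
    lie (a *: x + y) z = a *: lie x z + lie y z;
  lie_linearr : forall (z : L) (a : K) (x y : L),
    lie z (a *: x + y) = a *: lie z x + lie z y;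
  liexx : forall x : L, lie x x = 0;
  lie_jacobi : forall x y z : L,
    lie x (lie y z) + lie y (lie z x) + lie z (lie x y) = 0
}.

#[short(type="lieAlgType")]
HB.structure Definition LieAlgebra (K : fieldType) :=
  {L of isLieAlgebra K L & GRing.Lmodule K L}.

Section LieTheory.
Context {K : fieldType} {L : lieAlgType K}.

Lemma lieC (x y : L) : lie x y = - lie y x.
Proof.
have lieDl (u v w : L) : lie (u + v) w = lie u w + lie v w.
  by rewrite -[u]scale1r lie_linearl !scale1r.
have lieDr (u v w : L) : lie w (u + v) = lie w u + lie w v.
  by rewrite -[u]scale1r lie_linearr !scale1r.
apply/eqP; rewrite -addr_eq0; apply/eqP.
by have := liexx (x + y); rewrite lieDl !lieDr !liexx add0r addr0.
Qed.

End LieTheory.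

Record lieIdeal (K : fieldType) (L : lieAlgType K) := LieIdeal {
  ideal_set :> set L;
  ideal_subspace : subspace ideal_set;
  ideal_lie : forall u x : L, ideal_set u -> ideal_set (lie u x)
}.

Section QuotientPred.
Context {K : fieldType} {L : lieAlgType K} (I : lieIdeal L).

Definition ideal_pred : L -> bool := fun x => x \in (I : set L).

Lemma ideal_predE x : (x \in (ideal_pred : {pred L})) = (x \in (I : set L)).
Proof. by []. Qed.

Lemma ideal_zmod_closed : zmod_closed (ideal_pred : {pred L}).
Proof.
have [I0 IP] := ideal_subspace I.
split=> [|x y]; rewrite !ideal_predE; first exact/mem_set.
move=> /set_mem Ix /set_mem Iy; apply/mem_set.
by rewrite addrC -scaleN1r; exact: IP.
Qed.

Definition ideal_zmodClosed : zmodClosed L :=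
  HB.pack_for (zmodClosed L) ideal_pred
    (GRing.isZmodClosed.Build L ideal_pred ideal_zmod_closed).

Definition lieQuot : Type := Quotient.quot ideal_zmodClosed.

HB.instance Definition _ := GRing.Zmodule.on lieQuot.
HB.instance Definition _ := EqQuotient.on lieQuot.

Definition qproj (x : L) : lieQuot := \pi_lieQuot x.

Lemma qprojP x y : qproj x = qproj y <-> (I : set L) (x - y).
Proof.
rewrite /qproj; split=> [/eqP|h].
  by rewrite -(Quotient.idealrBE ideal_zmodClosed) => /set_mem.
by apply/eqP; rewrite -(Quotient.idealrBE ideal_zmodClosed); exact/mem_set.
Qed.

Lemma qprojK (w : lieQuot) : qproj (repr w) = w.
Proof. exact: reprK. Qed.

Lemma qprojD x y : qproj (x + y) = qproj x + qproj y.
Proof.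
exact: (raddfD (\pi_(Quotient.quot ideal_zmodClosed))).
Qed.

Definition qscale (a : K) (w : lieQuot) : lieQuot := qproj (a *: repr w).
Definition qlie (v w : lieQuot) : lieQuot := qproj (lie (repr v) (repr w)).

Lemma qscale_proj a x : qscale a (qproj x) = qproj (a *: x).
Proof.
apply/qprojP; rewrite -scalerBr -[_ *: _]addr0.
have [I0 IP] := ideal_subspace I; apply: IP => //.
by apply/qprojP; rewrite qprojK.
Qed.

Lemma lieBl (x y z : L) : lie (x - y) z = lie x z - lie y z.
Proof. by rewrite addrC -scaleN1r lie_linearl scaleN1r addrC. Qed.

Lemma lieBr (x y z : L) : lie z (x - y) = lie z x - lie z y.
Proof. by rewrite addrC -scaleN1r lie_linearr scaleN1r addrC. Qed.

Lemma qlie_proj x y : qlie (qproj x) (qproj y) = qproj (lie x y).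
Proof.
have [I0 IP] := ideal_subspace I.
have IN u : (I : set L) u -> (I : set L) (- u).
  by move=> Iu; rewrite -scaleN1r -[_ *: _]addr0; exact: IP.
have Irepr z : (I : set L) (repr (qproj z) - z).
  by apply/qprojP; rewrite qprojK.
apply: (@etrans _ _ (qproj (lie x (repr (qproj y))))); apply/qprojP.
  by rewrite -lieBl; exact: ideal_lie.
by rewrite -lieBr lieC; apply/IN/ideal_lie.
Qed.

Let qprojE (w : lieQuot) : exists x, w = qproj x.
Proof. by exists (repr w); rewrite qprojK. Qed.

Let qscaleA a b v : qscale a (qscale b v) = qscale (a * b) v.
Proof. by have [x ->] := qprojE v; rewrite !qscale_proj scalerA. Qed.

Let qscale1 : left_id 1 qscale.
Proof. by move=> v; have [x ->] := qprojE v; rewrite qscale_proj scale1r. Qed.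

Let qscaleDr : right_distributive qscale +%R.
Proof.
move=> a v w; have [x ->] := qprojE v; have [y ->] := qprojE w.
by rewrite -qprojD !qscale_proj scalerDr qprojD.
Qed.

Let qscaleDl v : {morph qscale^~ v : a b / a + b}.
Proof.
by move=> a b /=; have [x ->] := qprojE v; rewrite !qscale_proj scalerDl qprojD.
Qed.

HB.instance Definition _ :=
  GRing.Zmodule_isLmodule.Build K lieQuot qscaleA qscale1 qscaleDr qscaleDl.

Lemma qprojZ a x : qproj (a *: x) = a *: qproj x.
Proof. by rewrite -qscale_proj. Qed.

Let qlie_linearl (w : lieQuot) a (u v : lieQuot) :
  qlie (a *: u + v) w = a *: qlie u w + qlie v w.
Proof.
have [[[x ->] [y ->]] [z ->]] := (qprojE u, qprojE v, qprojE w).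
by rewrite -qprojZ -qprojD !qlie_proj lie_linearl qprojD qprojZ.
Qed.

Let qlie_linearr (w : lieQuot) a (u v : lieQuot) :
  qlie w (a *: u + v) = a *: qlie w u + qlie w v.
Proof.
have [[[x ->] [y ->]] [z ->]] := (qprojE u, qprojE v, qprojE w).
by rewrite -qprojZ -qprojD !qlie_proj lie_linearr qprojD qprojZ.
Qed.

Let qproj0 : qproj 0 = 0.
Proof. exact: (raddf0 (\pi_(Quotient.quot ideal_zmodClosed))). Qed.

Let qliexx (v : lieQuot) : qlie v v = 0.
Proof. by have [x ->] := qprojE v; rewrite qlie_proj liexx qproj0. Qed.

Let qlie_jacobi (u v w : lieQuot) :
  qlie u (qlie v w) + qlie v (qlie w u) + qlie w (qlie u v) = 0.
Proof.
have [[[x ->] [y ->]] [z ->]] := (qprojE u, qprojE v, qprojE w).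
by rewrite !qlie_proj -!qprojD lie_jacobi qproj0.
Qed.

HB.instance Definition _ :=
  isLieAlgebra.Build K lieQuot qlie_linearl qlie_linearr qliexx qlie_jacobi.

Lemma qproj_lie x y : qproj (lie x y) = lie (qproj x) (qproj y).
Proof. by rewrite -qlie_proj. Qed.

End QuotientPred.

Section LowerCentralSeries.
Context {K : fieldType} (L : lieAlgType K).

(* Numbered from 1: [lcs 1 = L] and [lcs k.+1 = [lcs k, L]] for [0 < k];
   [lcs 0 = L] is a dummy value. *)
Fixpoint lcs (k : nat) : set L :=
  match k with
  | k'.+1 =>
      match k' with
      | 0 => setT
      | _ => lspan [set lie x y | x in lcs k' & y in [set: L]]
      end
  | 0 => setT
  end.

Lemma lcs_subspace k : subspace (lcs k).
Proof. by case: k => [|[|k]] //; exact: lspan_subspace. Qed.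

Lemma lcsS k : lcs k.+1 `<=` lcs k.
Proof.
elim: k => [|[|k] IHk] //; apply: lspan_min; first exact: lcs_subspace.
move=> _ [x xk [y _ <-]]; apply: sub_lspan.
by exists x; [exact: IHk|exists y].
Qed.

Lemma lcs_lie k u x : lcs k u -> lcs k (lie u x).
Proof.
case: k => [|[|k]] // uk; apply: sub_lspan.
by exists u; [exact: (@lcsS k.+1)|exists x].
Qed.

Definition lcs_ideal k := LieIdeal (@lcs_subspace k) (@lcs_lie k).

Definition pro_nilpotent : Prop :=
  [/\ ~ finite_dim L,
      \bigcap_(i in [set i | (1 <= i)%N]) lcs i = [set 0] &
      forall i, (1 <= i)%N -> finite_dim (lieQuot (lcs_ideal i.+1))].

Definition Wquot (k : nat) : lieAlgType K := lieQuot (lcs_ideal k.+1).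

Definition Wproj (k : nat) : L -> Wquot k := @qproj K L (lcs_ideal k.+1).

(* The natural projection W_{k+1} -> W_k, computed on representatives;
   see [Wstep_proj]. *)
Definition Wstep (k : nat) (w : Wquot k.+1) : Wquot k := Wproj k (repr w).

Lemma Wstep_proj k x : Wstep (Wproj k.+1 x) = Wproj k x.
Proof.
by apply/qprojP/lcsS/(@qprojP _ _ (lcs_ideal k.+2)); rewrite qprojK.
Qed.

End LowerCentralSeries.

Arguments lcs {K} L k _.
Arguments Wquot {K} L k.
Arguments Wproj {K} L k _.
Arguments Wstep {K} L k _.

Section Tori.
Context {K : fieldType} {L : lieAlgType K}.
Implicit Types (D : L -> L).

Definition derivation D : Prop :=
  linear D /\ forall x y, D (lie x y) = lie (D x) y + lie x (D y).

Definition diagonal_in (B : set L) D : Prop :=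
  forall b, B b -> exists a : K, D b = a *: b.

Definition diagonalizable D : Prop :=
  exists2 B : set L, is_basis setT B & diagonal_in B D.

Definition torus (T : set (L -> L)) : Prop :=
  [/\ subspace T,
      forall D, T D -> derivation D,
      forall D E, T D -> T E -> D \o E = E \o D &
      forall D, T D -> diagonalizable D].

Definition maximal_torus (T : set (L -> L)) : Prop :=
  torus T /\ forall T', torus T' -> T `<=` T' -> T' = T.

Definition maximal_torus_in (B : set L) (T : set (L -> L)) : Prop :=
  maximal_torus T /\ forall D, T D -> diagonal_in B D.

End Tori.

Definition induced (L M : Type) (p : L -> M) (T : set (L -> L)) : set (M -> M) :=
  [set E : M -> M | exists2 D, T D & E \o p = p \o D].

Section ProNilpotentTori.
Context {K : fieldType} {N : lieAlgType K}.

(* The quotient N^i / N^{i+1} is the image of N^i in W_i = N / N^{i+1};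
   [B] is indexed from 1 and [B 0] is never used. *)
Definition compatible_basis (B : nat -> set N) : Prop :=
  is_basis setT (\bigcup_(i in [set i | (1 <= i)%N]) B i) /\
  forall i, (1 <= i)%N ->
    [/\ finite_set (B i), B i `<=` lcs N i,
        {in B i &, injective (Wproj N i)} &
        is_basis (Wproj N i @` lcs N i) (Wproj N i @` B i)].

Definition basisW (B : nat -> set N) (k : nat) : set (Wquot N k) :=
  Wproj N k @` \bigcup_(i in [set i | (1 <= i <= k)%N]) B i.

Arguments basisW B k _ : clear implicits.

Definition lim_tori (Tk : forall k, set (Wquot N k -> Wquot N k))
    (T : set (N -> N)) : Prop :=
  exists2 k0, (1 <= k0)%N &
    [/\ forall k, (k0 <= k)%N -> induced (Wstep N k) (Tk k.+1) = Tk k,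
        torus T,
        forall k, (k0 <= k)%N -> induced (Wproj N k) T = Tk k &
        forall T', torus T' ->
          (forall k, (k0 <= k)%N -> induced (Wproj N k) T' = Tk k) -> T' = T].

(* The last condition is a genuine one: for some maximal tori [T] no [B] admits
   such a family [Tk]. It cannot be dropped when comparing dimensions: let C[t]
   act on a torsion-free module V = E1 (+) E2 = F (+) A (+) B where all five
   summands are indecomposable; the two decompositions give maximal tori of
   dimensions 2 and 3 on C t (+) V, for suitable V. *)
Definition toral_data (T : set (N -> N)) (B : nat -> set N)
    (Tk : forall k, set (Wquot N k -> Wquot N k)) : Prop :=
  [/\ maximal_torus T,
      compatible_basis B,
      forall D, T D -> diagonal_in (\bigcup_(i in [set i | (1 <= i)%N]) B i) D &
      forall k, (1 <= k)%N -> maximal_torus_in (basisW B k) (Tk k)].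

End ProNilpotentTori.

(* Main.v *)
Require Import Defs.
From mathcomp Require Import all_boot all_order all_algebra.
From mathcomp Require Import complex.
From mathcomp Require Import all_classical all_reals.

Set Implicit Arguments.
Unset Strict Implicit.
Unset Printing Implicit Defensive.

Import Order.TTheory GRing.Theory Num.Theory.

Local Open Scope classical_set_scope.
Local Open Scope ring_scope.

(** Two facts carry the theorem.

    Maximality identifies a maximal torus that is diagonal in a basis with the
    set of all derivations that are diagonal in it
    ([maximal_diagonal_torus]); this applies to [T] on N and to every [Tk k].
    A diagonal derivation of N / N^(k+1) is determined by its weights on the
    finite set [B 1] ([diagonal_derivation_eq0]): if those vanish, the
    derivation sends N into N^2, hence N^i into N^(i+1) for every i, while a
    basis vector in [B i] survives modulo N^(i+1), so all its weights vanish.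
    The weight vectors of the tori [Tk k] on [B 1] thus form a decreasing
    chain of subspaces of a fixed finite-dimensional space. The chain
    stabilizes ([weights_stabilize]), and from then on a derivation in one
    [Tk k] extends to all later quotients; its weights at the successive
    levels fit together and define a diagonal operator on N which is a
    derivation modulo every N^k, hence a derivation ([diagonal_extend]). This
    gives the limit statement ([lim_tori_toral]) and, for k large, a linear
    bijection of [T] with [Tk k].

    The dimensions are then compared in one finite-dimensional quotient W, in
    which both tori induce maximal tori: two maximal tori of the derivation
    algebra g of a finite-dimensional algebra have the same dimension
    ([mx_maximal_torus_dim_le]). The usual proof conjugates the tori; here
    conjugacy is replaced by an infinitesimal count. For x in g let the rank
    of x be that of the pairing of the powers x^a with y in g by
    tr (x^a * y); this is the rank at x of the differential, on g, of the
    power traces, hence of the characteristic polynomial. A torus T contains a t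
    whose rank is at least dim T ([torus_det_traces_neq0]). Conversely, if T
    is maximal, every element of its centralizer has rank at most dim T
    ([cent_trace_degenerate]), and so has every conjugate of it by
    exponentials of nilpotent elements of g. Through a t in T that generates T
    these conjugates contain polynomial curves with an arbitrary tangent
    vector in g ([degenerate_tangent_all]), because g is the sum of the
    centralizer and the nonzero weight spaces of t. A minor vanishing on
    all those curves vanishes on g, as its lowest-order term at t would
    otherwise be nonzero along one of them ([det_traces_vanish]). So every
    element of g has rank at most dim T, and no torus is larger than a maximal
    one. *)

(** * Traces of powers of matrices *)

Section Traces.
Variables (F : numClosedFieldType) (n' : nat).
Local Notation n := n'.+1.
Local Notation M := 'M[F]_n.
Implicit Types (A B : M) (p : {poly F}).

Lemma mxtrace_nilpotent A k : A ^+ k = 0 -> \tr A = 0.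
Proof.
move=> Ak0; have [rs rsE] := closed_field_poly_normal (char_poly A).
rewrite (monicP (char_poly_monic A)) scale1r in rsE.
(* All eigenvalues are 0, so the characteristic polynomial is 'X^n. *)
have rs0 : {in rs, forall z, z = 0}.
  move=> z zrs; have: root (char_poly A) z by rewrite rsE root_prod_XsubC.
  rewrite -eigenvalue_root_char => /eigenvalueP[v vA v0].
  have vAm m : v *m A ^+ m = z ^+ m *: v.
    elim: m => [|m IH]; first by rewrite !expr0 mulmx1 scale1r.
    by rewrite exprSr mulmxA IH -scalemxAl vA scalerA -exprSr.
  have := vAm k; rewrite Ak0 mulmx0 => /esym/eqP.
  by rewrite scaler_eq0 (negbTE v0) orbF expf_eq0 => /andP[_ /eqP].
have cpE : char_poly A = 'X^(size rs).
  rewrite rsE (eq_big_seq (fun=> 'X)).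
    by rewrite big_const_seq count_predT iter_mulr_1.
  by move=> z /rs0 ->; rewrite subr0.
have szrs : size rs = n.
  by have := size_char_poly A; rewrite cpE size_polyXn => -[].
apply/eqP; rewrite -oppr_eq0 -char_poly_trace // cpE szrs coefXn.
by rewrite (ltn_eqF (ltnSn _)).
Qed.

Lemma horner_mx_conj_diag (P : M) (d : 'rV[F]_n) p : P \in unitmx ->
  horner_mx (invmx P *m diag_mx d *m P) p =
  invmx P *m diag_mx (map_mx (horner p) d) *m P.
Proof.
move=> Pu; have := horner_mx_uconjC p (diag_mx d) Pu.
by rewrite horner_mx_diag.
Qed.

Lemma diagonalizable_conj A : diagonalizable A ->
  exists2 P, P \in unitmx & exists d, A = invmx P *m diag_mx d *m P.
Proof.
move=> [P Pu /(diagonalizable_forLR Pu)[d ->]]; exists P => //; exists d.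
by rewrite -conjVmx.
Qed.

Lemma mxtrace_horner A B : (forall m, \tr (A ^+ m * B) = 0) ->
  forall p, \tr (horner_mx A p * B) = 0.
Proof.
move=> h p; rewrite /horner_mx /horner_morph horner_coef mulr_suml raddf_sum.
rewrite big1 // => i _; rewrite coef_map /= -mulrA [_ * (_ * _)]mul_scalar_mx.
by rewrite mxtraceZ h mulr0.
Qed.

Lemma horner_mx_mod_char A p :
  horner_mx A (p %% char_poly A) = horner_mx A p.
Proof.
rewrite [p in RHS](divp_eq p (char_poly A)) rmorphD rmorphM /=.
by rewrite Cayley_Hamilton mulr0 add0r.
Qed.

(** By Cayley-Hamilton the powers below n span all powers; the bound on the
    exponent leaves finitely many rows to choose a minor from. *)
Lemma mxtrace_horner_lt A B : (forall m, (m < n)%N -> \tr (A ^+ m * B) = 0) ->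
  forall p, \tr (horner_mx A p * B) = 0.
Proof.
move=> h p; rewrite -horner_mx_mod_char /horner_mx /horner_morph.
rewrite horner_coef mulr_suml raddf_sum.
rewrite big1 // => i _; rewrite coef_map /= -mulrA [_ * (_ * _)]mul_scalar_mx.
rewrite mxtraceZ h ?mulr0 //.
apply: (leq_trans (ltn_ord i)); apply: (leq_trans (size_poly _ _)).
rewrite -ltnS -(size_char_poly A) ltn_modp.
by rewrite -size_poly_eq0 size_char_poly.
Qed.

(** Test against a polynomial that isolates one nonzero eigenvalue; its
    multiplicity is nonzero because the characteristic is 0. *)
Lemma diagonalizable_trace0 A : diagonalizable A ->
  (forall m, \tr (A ^+ m * A) = 0) -> A = 0.
Proof.
move=> /diagonalizable_conj[P Pu [d Ad]] /mxtrace_horner trA.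
suff d0 : d = 0 by rewrite Ad d0 linear0 mulmx0 mul0mx.
apply/rowP => i; rewrite mxE; apply/eqP/negPn/negP => di0.
pose rs := undup [seq d 0 j | j <- enum 'I_n & d 0 j != d 0 i].
(* [p] vanishes at every eigenvalue except [d 0 i]. *)
pose p := \prod_(x <- rs) ('X - x%:P).
have pE j : d 0 j != d 0 i -> p.[d 0 j] = 0.
  move=> dj; apply/eqP; rewrite -[_ == 0]/(root p _) /p root_prod_XsubC mem_undup.
  by apply/mapP; exists j; rewrite // mem_filter dj mem_enum.
have pi : p.[d 0 i] != 0.
  rewrite -[_ == 0]/(root p _) /p root_prod_XsubC mem_undup; apply/mapP => -[j].
  by rewrite mem_filter => /andP[/eqP + _] /esym.
have := trA p; rewrite Ad horner_mx_conj_diag // -!mulmxE.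
rewrite mxtrace_mulC !mulmxA mulmxK // mxtrace_mulC !mulmxA mulmxV // mul1mx.
rewrite mulmx_diag mxtrace_diag.
rewrite (bigID (fun j => d 0 j == d 0 i)) /= [X in _ + X]big1 ?addr0; last first.
  by move=> j dj; rewrite !mxE pE ?mulr0.
rewrite (eq_bigr (fun=> d 0 i * p.[d 0 i])); last first.
  by move=> j /eqP dj; rewrite !mxE dj.
rewrite sumr_const => /eqP; rewrite mulrn_eq0 mulf_eq0 (negbTE pi) (negbTE di0).
rewrite !orbF => /eqP/card0_eq/(_ i).
by move=> di; have : (d 0 i == d 0 i) = false := di; rewrite eqxx.
Qed.

(** The difference of the two powers is a multiple of [B] by a matrix
    commuting with it, hence nilpotent. *)
Lemma mxtrace_exp_add_nilpotent A B k l : A * B = B * A -> B ^+ l = 0 ->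
  \tr ((A + B) ^+ k) = \tr (A ^+ k).
Proof.
move=> cAB Bl; apply/eqP; rewrite -subr_eq0 -raddfB /=.
have cAB' : GRing.comm (A + B) A by rewrite /GRing.comm mulrDl mulrDr cAB.
rewrite (subrXX_comm _ cAB') addrC addKr.
set S := \sum_(i < k) _.
have cBS : GRing.comm B S.
  apply: commr_sum => i _; apply: commrM; apply: commrX.
    by apply: commrD => //; exact: esym.
  exact: esym.
apply/eqP/(@mxtrace_nilpotent _ l).
by rewrite exprMn_comm // Bl mul0r.
Qed.

Lemma mxtrace_comm_nilpotent A B l : A * B = B * A -> B ^+ l = 0 ->
  \tr (A * B) = 0.
Proof.
move=> cAB Bl; apply: (@mxtrace_nilpotent _ l).
by rewrite exprMn_comm // Bl mulr0.
Qed.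
End Traces.

(** * Tori of matrices and their generators *)

Section Interp.
Variable F : numClosedFieldType.

Lemma poly_interpolation (rs : seq F) (f : F -> F) :
  uniq rs -> exists p : {poly F}, forall x, x \in rs -> p.[x] = f x.
Proof.
elim: rs => [|x rs IH] /=; first by exists 0.
move=> /andP[xrs /IH[p pE]]; pose q := \prod_(y <- rs) ('X - y%:P).
have qx : q.[x] != 0 by rewrite -[_ == 0]/(root q x) /q root_prod_XsubC.
exists (p + ((f x - p.[x]) / q.[x]) *: q) => y; rewrite inE !hornerE.
case/predU1P => [->|yrs]; first by rewrite divfK // addrC subrK.
have /eqP-> : q.[y] == 0 by rewrite -[_ == 0]/(root q y) /q root_prod_XsubC.
by rewrite mulr0 addr0 pE.
Qed.

(** Vectors on which finitely many nonzero linear forms all survive: on the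
    line through two vectors the forms multiply to a nonzero polynomial. *)
Lemma exists_generic (V : lmodType F) (U : V -> Prop) (I : eqType) (s : seq I)
    (l : I -> V -> F) :
    U 0 -> (forall (c : F) u v, U u -> U v -> U (u + c *: v)) ->
    (forall i u (c : F) v, l i (u + c *: v) = l i u + c * l i v) ->
    (forall i, i \in s -> exists2 a, U a & l i a != 0) ->
  exists2 t, U t & forall i, i \in s -> l i t != 0.
Proof.
move=> U0 UP lP; elim: s => [|i s IH] h; first by exists 0.
have [|t Ut tP] := IH; first by move=> j js; apply: h; rewrite inE js orbT.
have [a Ua la] := h i (mem_head _ _).
pose q := \prod_(j <- i :: s) ((l j t)%:P + l j a *: 'X).
have : q != 0.
  rewrite prodf_seq_neq0; apply/allP => j js /=.
  move: js; rewrite inE => /predU1P[->|/tP ljt].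
    apply: contraNneq la => /(congr1 (fun p : {poly F} => p`_1)).
    by rewrite coefD coefC coefZ coefX /= add0r mulr1 coef0 => ->.
  apply: contraNneq ljt => /(congr1 (fun p : {poly F} => p`_0)).
  by rewrite coefD coefC coefZ coefX /= mulr0 addr0 coef0 => ->.
move=> /closed_nonrootP[c]; rewrite rootE horner_prod prodf_seq_neq0 => /allP qc.
exists (t + c *: a); first exact: UP.
by move=> j /qc /=; rewrite lP !hornerE mulrC.
Qed.
End Interp.

Section Torus.
Variables (F : numClosedFieldType) (n' : nat).
Local Notation n := n'.+1.
Local Notation M := 'M[F]_n.
Variable T : {vspace M}.
Hypothesis Tc : {in T &, forall a b : M, a * b = b * a}.
Hypothesis Td : {in T, forall a : M, diagonalizable a}.

Lemma torus_diag : exists2 P : M, P \in unitmx &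
  {in T, forall a : M, a = invmx P *m diag_mx (\row_i (P *m a *m invmx P) i i) *m P}.
Proof.
have [|P Pu PT] := (codiagonalizableP (vbasis T)).1.
  by split=> [a b aT bT|a aT]; [apply: Tc|apply: Td]; exact: vbasis_mem.
exists P => // a aT.
have Pa : is_diag_mx (P *m a *m invmx P).
  rewrite (coord_vbasis aT) mulmx_sumr mulmx_suml.
  apply/is_diag_mxP => i j ij; rewrite summxE big1 // => k _.
  rewrite -scalemxAr -scalemxAl mxE.
  have /allP/(_ _ (mem_nth 0 _)) /= dk := PT.
  by rewrite (elimT (diagonalizable_forP _ Pu) (dk k _)) ?mulr0 // size_tuple.
have {Pa}/diag_mxP[d dE] := Pa.
have -> : (\row_i (P *m a *m invmx P) i i) = d.
  by apply/rowP => i; rewrite mxE dE mxE eqxx.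
by rewrite -dE !mulmxA mulVmx // mul1mx mulmxKV.
Qed.

(** Take [t] separating all pairs of distinct weights of [T]; interpolation on
    its eigenvalues then recovers every element of [T]. In particular the
    centralizer of [t] is that of [T]. *)
Lemma torus_generator : exists2 t : M, t \in T &
  {in T, forall a : M, exists p, a = horner_mx t p}.
Proof.
have [P Pu PT] := torus_diag.
pose w (a : M) (i : 'I_n) := (P *m a *m invmx P) i i.
pose l (ij : 'I_n * 'I_n) (a : M) := w a ij.1 - w a ij.2.
pose s := [seq ij <- enum {: 'I_n * 'I_n} | `[< exists2 a, a \in T & l ij a != 0 >]].
have [||||t tT tP] := @exists_generic F M (fun a => a \in T) _ s l.
- exact: mem0v.
- by move=> c u v uT vT; rewrite memvD ?memvZ.
- move=> ij u c v; rewrite /l /w !mulmxDr !mulmxDl -!scalemxAr -!scalemxAl.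
  by rewrite !mxE mulrBr opprD addrACA.
- by move=> ij; rewrite mem_filter => /andP[/asboolP].
exists t => // a aT.
have wE i j : w t i = w t j -> w a i = w a j.
  move=> tij; apply/eqP; rewrite -subr_eq0; apply: contraT => aij.
  have /tP : (i, j) \in s.
    by rewrite mem_filter mem_enum andbT; apply/asboolP; exists a.
  by rewrite /l /= tij subrr eqxx.
pose rs := undup [seq w t i | i <- enum 'I_n].
(* The weight of [a] at any index where [t] has weight [x]; the default 0 is
   never reached on [rs]. *)
pose f x := oapp (w a) 0 [pick i | w t i == x].
have [p pE] := poly_interpolation f (undup_uniq _ : uniq rs).
exists p; rewrite (PT _ tT) horner_mx_conj_diag // [LHS](PT _ aT).
congr (_ *m diag_mx _ *m _); apply/rowP => i; rewrite [LHS]mxE [RHS]mxE.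
rewrite -/(w a i) [in RHS]mxE -/(w t i) pE; last first.
  by rewrite mem_undup; apply/mapP; exists i; rewrite ?mem_enum.
rewrite /f; case: pickP => [j /eqP/wE/esym//|h].
by have : (w t i == w t i) = false := h i; rewrite eqxx.
Qed.
End Torus.

(** * Semisimple parts and derivations of bilinear products *)

Section Jordan.
Variables (F : numClosedFieldType) (n' : nat).
Local Notation n := n'.+1.
Local Notation M := 'M[F]_n.
Variable A : M.
Implicit Types (p : {poly F}) (v : 'rV[F]_n).

(** Chinese remaindering on the coprime powers of the linear factors of the
    characteristic polynomial gives the projections onto the generalized
    eigenspaces as polynomials in [A]. *)
Lemma jordan_idempotents : exists rs : seq F, exists e : F -> {poly F},
  [/\ uniq rs,
      \sum_(x <- rs) horner_mx A (e x) = 1 &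
      forall x, x \in rs -> horner_mx A (e x) * (A - x%:M) ^+ n = 0].
Proof.
have [zs zsE] := closed_field_poly_normal (char_poly A).
rewrite (monicP (char_poly_monic A)) scale1r in zsE.
have szzs : size zs = n.
  by have := size_char_poly A; rewrite zsE size_prod_XsubC => -[].
pose rs := undup zs; pose q (x : F) := ('X - x%:P) ^+ n.
pose Q := \prod_(x <- rs) q x.
have QA : horner_mx A Q = 0.
  suff /dvdpP[r ->] : char_poly A %| Q by rewrite rmorphM /= Cayley_Hamilton mulr0.
  rewrite zsE -big_undup_iterop_count /Q.
  apply: (big_ind2 (fun p1 p2 => p1 %| p2)) => [|? ? ? ?|x _].
  - exact: dvdpp.
  - exact: dvdp_mul.
  rewrite -[iterop _ _ _ _]/((_ : {poly F}) ^+ count_mem x zs) /q.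
  by rewrite dvdp_exp2l // -szzs count_size.
have cq x y : x != y -> coprimep (q x) (q y).
  move=> xy; apply/coprimep_expl/coprimep_expr.
  by rewrite coprimep_XsubC root_XsubC eq_sym.
pose h x := \prod_(y <- rs | y != x) q y.
have cqh x : coprimep (q x) (h x).
  rewrite /h; elim: (rs) => [|y s IH]; first by rewrite big_nil coprimep1.
  by rewrite big_cons; case: ifP => // yx; rewrite coprimepMr IH cq // eq_sym yx.
have /choice[e0 e0P] x : exists u : {poly F}, q x %| u * h x - 1.
  have /Bezout_eq1_coprimepP[[a b] /= ab] := cqh x.
  exists b; rewrite -ab opprD addrCA subrr addr0 -mulNr.
  exact: dvdp_mulIr.
have urs : uniq rs by exact: undup_uniq.
have Qh x : x \in rs -> Q = q x * h x.
  by move=> xrs; rewrite /Q /h (bigD1_seq x).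
exists rs, (fun x => e0 x * h x); split => //.
  have /dvdpP[r rE] : Q %| \sum_(x <- rs) e0 x * h x - 1.
    have : forall y, y \in rs -> q y %| \sum_(x <- rs) e0 x * h x - 1.
      move=> y yrs; rewrite (bigD1_seq y) //= addrAC dvdp_add //.
      rewrite big_seq_cond; apply: (big_ind (fun p => q y %| p)).
      - exact: dvdp0.
      - by move=> ? ? ? ?; exact: dvdp_add.
      move=> x /andP[xrs xy]; apply: dvdp_mull.
      by rewrite /h (big_rem y) //= eq_sym xy dvdp_mulIl.
    rewrite /Q; move: (_ - 1) => P; elim: (rs) urs => [|y s IH] /=.
      by rewrite big_nil dvd1p.
    move=> /andP[ys us] dP; rewrite big_cons Gauss_dvdp.
      by rewrite dP ?mem_head //= IH // => z zs'; rewrite dP // inE zs' orbT.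
    rewrite big_seq; elim/big_rec: _ => [|z p zs' cp]; first exact: coprimep1.
    by rewrite coprimepMr cp cq //; apply: contraNneq ys => ->.
  rewrite -raddf_sum /= -[\sum_(x <- rs) _](subrK 1) rE rmorphD rmorphM /= QA.
  by rewrite mulr0 add0r rmorph1.
move=> x xrs.
have -> : (A - x%:M) ^+ n = horner_mx A (q x).
  by rewrite rmorphXn rmorphB /= horner_mx_X horner_mx_C.
by rewrite -rmorphM /= -mulrA [h x * _]mulrC -Qh // rmorphM /= QA mulr0.
Qed.
End Jordan.

Section Jordan.
Variables (F : numClosedFieldType) (n' : nat).
Local Notation n := n'.+1.
Local Notation M := 'M[F]_n.

Definition generalized_eigenvector (A : M) (x : F) (v : 'rV[F]_n) :=
  exists k, v *m (A - x%:M) ^+ k = 0.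

(** The semisimple part acts by [x] on every generalized eigenvector for [x],
    even when [x] is no eigenvalue; this uniformity serves the application to
    sums of eigenvalues in [mx_derivation_jordan]. *)
Lemma semisimple_part (A : M) : exists p, let S := horner_mx A p in
  [/\ diagonalizable S, (A - S) ^+ n = 0,
      forall x v, generalized_eigenvector A x v -> v *m S = x *: v &
      forall v, exists s : seq (F * 'rV[F]_n),
        (forall q, q \in s -> generalized_eigenvector A q.1 q.2) /\
        v = \sum_(q <- s) q.2].
Proof.
have [rs [e [urs e1 eP]]] := jordan_idempotents A.
pose p := \sum_(x <- rs) x *: e x.
exists p => /=; set S := horner_mx A p.
have SE : S = \sum_(x <- rs) x *: horner_mx A (e x).
  by rewrite /S /p raddf_sum; apply: eq_bigr => x _; rewrite /= linearZ.
have decomp (v : 'rV_n) : v = \sum_(x <- rs) v *m horner_mx A (e x).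
  by rewrite -mulmx_sumr e1 mulmx1.
have genP x v : generalized_eigenvector A x v -> v *m S = x *: v.
  move=> [k vk]; rewrite {2}(decomp v) SE mulmx_sumr scaler_sumr.
  rewrite !big_seq; apply: eq_bigr => y yrs; rewrite -scalemxAr.
  have [->//|yx] := eqVneq y x.
  suff -> : v *m horner_mx A (e y) = 0 by rewrite !scaler0.
  have /Bezout_eq1_coprimepP[[a b] /= ab] :
      coprimep (('X - y%:P) ^+ n) (('X - x%:P) ^+ k).
    apply/coprimep_expl/coprimep_expr.
    by rewrite coprimep_XsubC root_XsubC eq_sym.
  have hX z m : horner_mx A (('X - z%:P) ^+ m) = (A - z%:M) ^+ m.
    by rewrite rmorphXn rmorphB /= horner_mx_X horner_mx_C.
  set w := v *m _.
  have wy : w *m horner_mx A (('X - y%:P) ^+ n) = 0.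
    by rewrite hX -mulmxA mulmxE eP // mulmx0.
  have wx : w *m horner_mx A (('X - x%:P) ^+ k) = 0.
    by rewrite -mulmxA mulmxE -rmorphM mulrC rmorphM /= -mulmxE mulmxA hX vk mul0mx.
  have -> : w = w *m horner_mx A 1 by rewrite rmorph1 mulmx1.
  rewrite -ab [a * _]mulrC [b * _]mulrC.
  by rewrite rmorphD !rmorphM /= mulmxDr -!mulmxE !mulmxA wx wy !mul0mx addr0.
have eS x : x \in rs -> horner_mx A (e x) * S = x *: horner_mx A (e x).
  move=> xrs; apply/row_matrixP => i; rewrite row_mul linearZ /=; apply: genP.
  by exists n; rewrite -row_mul [_ *m _]eP // row0.
have SA : S * A = A * S.
  by rewrite -[A in LHS]horner_mx_X -[A in RHS]horner_mx_X -!rmorphM mulrC.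
split=> //.
- apply/diagonalizableP; exists rs => //; apply: mxminpoly_min.
  rewrite -[LHS]mul1r -e1 mulr_suml; apply: big1_seq => x /= xrs.
  rewrite (big_rem x) //= rmorphM /= mulrA rmorphB /= horner_mx_X horner_mx_C.
  by rewrite mulrBr eS // [_ * _%:M]mul_mx_scalar subrr mul0r.
- rewrite -[LHS]mul1r -e1 mulr_suml; apply: big1_seq => x /= xrs.
  suff -> : forall k, horner_mx A (e x) * (A - S) ^+ k =
      horner_mx A (e x) * (A - x%:M) ^+ k by exact: eP.
  have cA : GRing.comm (horner_mx A (e x)) (A - x%:M).
    apply: commrB; last by rewrite /GRing.comm [LHS]mul_mx_scalar [RHS]mul_scalar_mx.
    by rewrite /GRing.comm -{2 3}[A]horner_mx_X -!rmorphM mulrC.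
  elim=> [//|k IH]; rewrite !exprS !mulrA mulrBr eS //.
  by rewrite -[x *: _]mul_mx_scalar -mulrBr cA -!mulrA IH.
- move=> v; exists [seq (x, v *m horner_mx A (e x)) | x <- rs]; split.
    move=> _ /mapP[x xrs ->] /=; exists n.
    by rewrite -mulmxA mulmxE eP // mulmx0.
  by rewrite big_map -decomp.
Qed.
End Jordan.

Section Derivations.
Variables (F : numClosedFieldType) (n' : nat).
Local Notation n := n'.+1.
Local Notation M := 'M[F]_n.
Variable br : 'rV[F]_n -> 'rV[F]_n -> 'rV[F]_n.
Hypothesis brl : forall z a x y, br (a *: x + y) z = a *: br x z + br y z.
Hypothesis brr : forall z a x y, br z (a *: x + y) = a *: br z x + br z y.

Definition mx_derivation (D : M) :=
  forall x y, br x y *m D = br (x *m D) y + br x (y *m D).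

Let brDl z x y : br (x + y) z = br x z + br y z.
Proof. by have := brl z 1 x y; rewrite !scale1r. Qed.
Let brDr z x y : br z (x + y) = br z x + br z y.
Proof. by have := brr z 1 x y; rewrite !scale1r. Qed.
Let br0l z : br 0 z = 0.
Proof. by apply: (addrI (br 0 z)); rewrite -brDl !addr0. Qed.
Let br0r z : br z 0 = 0.
Proof. by apply: (addrI (br z 0)); rewrite -brDr !addr0. Qed.
Let brZl z a x : br (a *: x) z = a *: br x z.
Proof. by have := brl z a x 0; rewrite br0l !addr0. Qed.
Let brZr z a x : br z (a *: x) = a *: br z x.
Proof. by have := brr z a x 0; rewrite br0r !addr0. Qed.

Let brNl z x : br (- x) z = - br x z.
Proof. by rewrite -scaleN1r brZl scaleN1r. Qed.
Let brNr z x : br z (- x) = - br z x.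
Proof. by rewrite -scaleN1r brZr scaleN1r. Qed.

Lemma mx_derivation_lin a D E :
  mx_derivation D -> mx_derivation E -> mx_derivation (a *: D + E).
Proof.
move=> dD dE x y; rewrite !mulmxDr -!scalemxAr dD dE brl brr scalerDr.
by rewrite addrACA.
Qed.

Lemma mx_derivation0 : mx_derivation 0.
Proof. by move=> x y; rewrite !mulmx0 br0l br0r addr0. Qed.

Lemma mx_derivation_comm D E :
  mx_derivation D -> mx_derivation E -> mx_derivation (D * E - E * D).
Proof.
move=> dD dE x y.
rewrite -!mulmxE !mulmxBr !mulmxA dD dE !mulmxDl !dD !dE brDl brDr brNl brNr.
rewrite [br (x *m E) _ + _]addrC addrACA [br (x *m D) _ + br x _]addrC.
rewrite [br (x *m E *m D) _ + _ + _]addrACA [br (x *m D) _ + _]addrC.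
by rewrite opprD addrACA subrr addr0 opprD addrACA.
Qed.

(** Leibniz: [D - (a + b)] acts on a product as the sum of [D - a] on the
    left factor and [D - b] on the right one. *)
Lemma generalized_eigenvector_br D a b x y : mx_derivation D ->
  generalized_eigenvector D a x -> generalized_eigenvector D b y ->
  generalized_eigenvector D (a + b) (br x y).
Proof.
move=> dD [k xk] [l yl]; exists (k + l)%N; move: {2}(k + l)%N (erefl (k + l)%N) => m.
elim: m k l x y xk yl => [|m IH] k l x y.
  move=> xk _ /eqP; rewrite addn_eq0 => /andP[/eqP k0 _].
  by move: xk; rewrite k0 expr0 mulmx1 => ->; rewrite br0l mul0mx.
have key : br x y *m (D - (a + b)%:M) =
    br (x *m (D - a%:M)) y + br x (y *m (D - b%:M)).
  rewrite !mulmxBr dD !mul_mx_scalar brDl brDr brNl brNr brZl brZr.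
  by rewrite scalerDl opprD addrACA.
case: k => [|k] xk.
  by move: xk; rewrite expr0 mulmx1 => -> *; rewrite br0l mul0mx.
case: l => [|l] yl kl.
  by move: yl; rewrite expr0 mulmx1 => -> *; rewrite br0r mul0mx.
rewrite addSn exprS -mulmxE mulmxA key mulmxDl.
rewrite (IH k l.+1) ?add0r; first last.
- by move: kl => [].
- by [].
- by rewrite -mulmxA mulmxE -exprS.
rewrite addnS -addSn (IH k.+1 l) //; last by move: kl; rewrite addnS => -[].
by rewrite -mulmxA mulmxE -exprS.
Qed.

(** Eigenvalues add under the product ([generalized_eigenvector_br]), so
    the operator that acts by the eigenvalue on generalized eigenvectors
    satisfies the Leibniz rule. *)
Lemma mx_derivation_jordan D : mx_derivation D -> exists p,
  let S := horner_mx D p in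
  [/\ mx_derivation S, diagonalizable S & (D - S) ^+ n = 0].
Proof.
move=> dD; have [p /= [dS nS Sg dec]] := semisimple_part D; exists p; split=> // x y.
set S := horner_mx D p in dS nS Sg *.
have [[s [sP ->]] [t [tP ->]]] := (dec x, dec y).
elim: s sP => [|[a u] s IH] sP.
  by rewrite !big_nil mul0mx !br0l mul0mx addr0.
rewrite big_cons /= mulmxDl !brDl mulmxDl IH; last first.
  by move=> q qs; apply: sP; rewrite inE qs orbT.
rewrite addrACA; congr (_ + _).
have {sP}ga := sP (a, u) (mem_head _ _).
rewrite /= in ga; rewrite (Sg _ _ ga) brZl.
elim: t {IH} tP => [|[b v] t IHt] tP.
  by rewrite !big_nil mul0mx !br0r mul0mx scaler0 addr0.
rewrite big_cons /= mulmxDl !brDr mulmxDl IHt; last first.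
  by move=> q qs; apply: tP; rewrite inE qs orbT.
rewrite scalerDr addrACA; congr (_ + _).
have {tP}gb := tP (b, v) (mem_head _ _).
rewrite /= in gb; rewrite (Sg _ _ gb) brZr (Sg (a + b)) ?scalerDl //.
exact: generalized_eigenvector_br.
Qed.
End Derivations.

(** A stable subspace contains the eigencomponents of its vectors; applying
    [f - a] removes the eigenvalue [a] and allows induction on the list of
    eigenvalues. *)
Lemma eigenvector_split (F : fieldType) (V : lmodType F) (U : V -> Prop)
    (f : V -> V) (A : seq F) (s : seq (F * V)) :
    (forall a u v, U u -> U v -> U (a *: u + v)) -> U 0 ->
    linear f -> (forall u, U u -> U (f u)) -> uniq A ->
    (forall q, q \in s -> q.1 \in A /\ f q.2 = q.1 *: q.2) ->
    U (\sum_(q <- s) q.2) ->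
  exists2 s' : seq (F * V),
    forall q, q \in s' -> [/\ q.1 \in A, U q.2 & f q.2 = q.1 *: q.2] &
    \sum_(q <- s) q.2 = \sum_(q <- s') q.2.
Proof.
move=> UP U0 fl fU.
have fD u v : f (u + v) = f u + f v by have := fl 1 u v; rewrite !scale1r.
have f0 : f 0 = 0 by apply: (addrI (f 0)); rewrite -fD !addr0.
have fZ a u : f (a *: u) = a *: f u by have := fl a u 0; rewrite f0 !addr0.
have fB u v : f (u - v) = f u - f v by rewrite fD -scaleN1r fZ scaleN1r.
have fS (r : seq (F * V)) (h : F * V -> V) :
    f (\sum_(q <- r) h q) = \sum_(q <- r) f (h q) by exact: big_morph.
elim: A s => [|a A IH] s /=.
  move=> _ sP _; case: s sP => [|q s] sP; first by exists [::]; rewrite ?big_nil.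
  by have [] := sP q (mem_head _ _).
move=> /andP[aA uA] sP; set y := \sum_(q <- s) q.2 => Uy.
(* The expansion of [f y - a *: y]. *)
pose s1 := [seq (q.1, (q.1 - a) *: q.2) | q <- s & q.1 != a].
have s1P q : q \in s1 -> q.1 \in A /\ f q.2 = q.1 *: q.2.
  move=> /mapP[q0]; rewrite mem_filter => /andP[qa qs] -> /=.
  have [+ fq] := sP _ qs; rewrite inE (negbTE qa) /= => qA; split=> //.
  by rewrite fZ fq !scalerA mulrC.
have zE : f y - a *: y = \sum_(q <- s1) q.2.
  rewrite big_map big_filter /y scaler_sumr fS -sumrB.
  rewrite [RHS]big_mkcond /= !big_seq; apply: eq_bigr => q /sP[_ ->].
  by rewrite -scalerBl; case: eqVneq => [->|//]; rewrite subrr scale0r.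
have [|s2 s2P s2E] := IH s1 uA s1P.
  by rewrite -zE -scaleNr addrC; apply: (UP) => //; exact: fU.
pose y' := y - \sum_(q <- s2) (q.1 - a)^-1 *: q.2.
exists ((a, y') :: [seq (q.1, (q.1 - a)^-1 *: q.2) | q <- s2]); last first.
  by rewrite big_cons big_map /= subrK.
have qa q : q \in s2 -> q.1 - a != 0.
  by move=> /s2P[qA _ _]; rewrite subr_eq0; apply: contraNneq aA => <-.
move=> q; rewrite inE => /predU1P[->|/mapP[q0 q0s ->]] /=; last first.
  have [qA Uq fq] := s2P _ q0s; split.
  - by rewrite inE qA orbT.
  - by rewrite -[_ *: _]addr0; exact: (UP).
  - by rewrite fZ fq !scalerA mulrC.
split; first exact: mem_head.
  rewrite /y' addrC -scaleN1r; apply: (UP) => //.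
  rewrite big_seq; apply: (big_ind U) => // [u v Uu Uv|q0 /s2P[_ Uq _]].
    by rewrite -[u]scale1r; exact: (UP).
  by rewrite -[_ *: _]addr0; exact: (UP).
apply/eqP; rewrite -subr_eq0 /y'; set S := \sum_(q <- s2) _.
have -> : f (y - S) - a *: (y - S) = (f y - a *: y) - (f S - a *: S).
  by rewrite fB scalerBr !opprB (addrC (a *: S)) addrACA (addrC (- f S)).
rewrite zE s2E subr_eq0 /S fS scaler_sumr -sumrB /=.
rewrite !big_seq; apply/eqP; apply: eq_bigr => q1 qs.
have [_ _ fq] := s2P _ qs.
rewrite fZ fq !scalerA -scalerBl mulrC -mulrBl divff ?scale1r //.
exact: qa.
Qed.

(** * Exponential curves of nilpotent matrices *)

Section Exp.
Variables (F : numClosedFieldType) (n' : nat).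
Local Notation n := n'.+1.
Local Notation M := 'M[F]_n.

(** Curves of matrices are polynomials with matrix coefficients, evaluated at
    scalars; the coefficient ring is not commutative, but scalars are
    central. *)
Definition mx_curve_eval (s : F) (p : {poly M}) : M := p.[s%:M].
Local Notation ev := mx_curve_eval.

Lemma mx_curve_eval_comm s (p : {poly M}) : comm_poly p s%:M.
Proof. by rewrite /comm_poly [LHS]mul_scalar_mx [RHS]mul_mx_scalar. Qed.

Lemma mx_curve_evalM s p q : ev s (p * q) = ev s p * ev s q.
Proof. exact/hornerM_comm/mx_curve_eval_comm. Qed.

Lemma mx_curve_evalC s a : ev s a%:P = a.
Proof. exact: hornerC. Qed.

Lemma mx_curve_evalE s p : ev s p = \sum_(i < size p) s ^+ i *: p`_i.
Proof.
rewrite /ev horner_coef; apply: eq_bigr => i _.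
have -> : (s%:M : M) ^+ i = (s ^+ i)%:M by rewrite rmorphXn.
exact: mul_mx_scalar.
Qed.

Definition exp_curve (v : M) (m : nat) : {poly M} :=
  \poly_(k < m) (k`!%:R^-1 *: v ^+ k).

Lemma coef_exp_curve v m k : v ^+ m = 0 -> (exp_curve v m)`_k = k`!%:R^-1 *: v ^+ k.
Proof.
move=> vm; rewrite coef_poly; case: ltnP => // mk.
by rewrite -(subnKC mk) exprD vm mul0r scaler0.
Qed.

Lemma deriv_exp_curve v m : v ^+ m = 0 ->
  (exp_curve v m)^`() = v%:P * exp_curve v m.
Proof.
move=> vm; apply/polyP => k.
rewrite coef_deriv coefCM !coef_exp_curve // -scaler_nat scalerA factS natrM invfM.
by rewrite mulrA divff ?pnatr_eq0 // mul1r exprS scalerAr.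
Qed.

Lemma exp_curve_comm v m : v ^+ m = 0 -> exp_curve v m * v%:P = v%:P * exp_curve v m.
Proof.
move=> vm; apply/polyP => k; rewrite coefMC coefCM !coef_exp_curve //.
by rewrite -scalerAl -scalerAr -exprSr -exprS.
Qed.

Section Conj.
Variables (v : M) (m : nat).
Hypothesis vm : v ^+ m = 0.
Let vNm : (- v) ^+ m = 0. Proof. by rewrite exprNn vm mulr0. Qed.

(** The conjugated curve [A] satisfies the differential equation
    A' = A v - v A, so its coefficients are iterated brackets of [Y] with [v]
    up to scalars. Hence conjugation by the exponential of [v] preserves any
    Lie algebra containing [v]. *)
Lemma exp_curve_conj_coef (U : M -> Prop) (Y : M) :
    (forall (a : F) u w, U u -> U w -> U (a *: u + w)) ->
    (forall w, U w -> U (w * v - v * w)) -> U 0 -> U Y ->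
  forall k, U (exp_curve (- v) m * Y%:P * exp_curve v m)`_k.
Proof.
move=> Ulin Uv U0 UY; set B := _ * _ * _.
have dB : B^`() = B * v%:P - v%:P * B.
  rewrite /B !derivM derivC mulr0 addr0 !deriv_exp_curve // polyCN mulNr addrC.
  rewrite ?mulNr -(exp_curve_comm vm) !mulrA. reflexivity.
elim=> [|k IH].
  rewrite /B !coefM !big_ord1 /= coefMC !coef_exp_curve // fact0 invr1 !expr0.
  by rewrite scale1r mul1r mulr1.
have := congr1 (fun p : {poly M} => p`_k) dB.
rewrite coef_deriv coefB coefMC coefCM => BE.
have -> : B`_k.+1 = k.+1%:R^-1 *: (B`_k * v - v * B`_k).
  by rewrite -BE -scaler_nat scalerA mulVf ?scale1r // pnatr_eq0.
by rewrite -[_ *: _]addr0; apply: (Ulin) => //; exact: Uv.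
Qed.

Lemma exp_curve_inv : exp_curve (- v) m * exp_curve v m = 1.
Proof.
have dB : (exp_curve (- v) m * exp_curve v m)^`() =
    (exp_curve (- v) m * exp_curve v m) * v%:P
    - v%:P * (exp_curve (- v) m * exp_curve v m).
  by rewrite derivM !deriv_exp_curve // polyCN !mulNr addrC !mulrA -!mulrA -(exp_curve_comm vm).
set B := _ * _ in dB *.
have BC : B * v%:P = v%:P * B.
  apply/polyP => k; rewrite coefMC coefCM.
  have -> : B = exp_curve (- v) m * 1%:P * exp_curve v m by rewrite polyC1 mulr1.
  apply: (@exp_curve_conj_coef (fun w => w * v = v * w) 1).
  - by move=> a u w uv wv; rewrite mulrDl mulrDr -scalerAl -scalerAr uv wv.
  - by move=> w ->; rewrite subrr mul0r mulr0.
  - by rewrite mul0r mulr0.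
  - by rewrite mul1r mulr1.
apply/polyP => -[|k]; rewrite coef1 /=.
  by rewrite /B coefM big_ord1 !coef_exp_curve // fact0 invr1 !expr0 !scale1r mulr1.
have := congr1 (fun p : {poly M} => p`_k) dB.
rewrite BC subrr coef0 coef_deriv -scaler_nat => /eqP.
by rewrite scaler_eq0 pnatr_eq0 /= => /eqP.
Qed.
End Conj.
End Exp.

Section TraceDeriv.
Variables (F : numClosedFieldType) (n' : nat).
Local Notation n := n'.+1.
Local Notation M := 'M[F]_n.

(** The trace is cyclic, so the terms of the derivative of a power all
    contribute equally. *)
Lemma mxtrace_coef1_line (c y : M) k :
  \tr (((c%:P + y%:P * 'X) ^+ k.+1 : {poly M})`_1) = k.+1%:R * \tr (c ^+ k * y).
Proof.
set p := c%:P + _.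
have p0 : p`_0 = c by rewrite coefD coefC coefMX /= addr0.
have p1 : p`_1 = y by rewrite coefD coefC coefMX coefC /= add0r.
have pk0 j : (p ^+ j)`_0 = c ^+ j.
  elim: j => [|j IH]; first by rewrite !expr0 coef1.
  by rewrite exprS coefM big_ord1 p0 IH exprS.
have pk1 j : (p ^+ j.+1)`_1 = \sum_(i < j.+1) c ^+ i * y * c ^+ (j - i).
  elim: j => [|j IH]; first by rewrite big_ord1 expr1 p1 !expr0 mul1r mulr1.
  rewrite exprS coefM big_ord_recl big_ord1 /= p0 p1 subn0 IH subnn.
  rewrite pk0 [RHS]big_ord_recl /= expr0 mul1r subn0 addrC; congr (_ + _).
  rewrite mulr_sumr; apply: eq_bigr => i _.
  by rewrite !mulrA -exprS subSS.
rewrite pk1 raddf_sum (eq_bigr (fun=> \tr (c ^+ k * y))) => [|i _].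
  by rewrite sumr_const card_ord mulr_natl.
rewrite /= -mulmxE mxtrace_mulC mulmxE mulrA -exprD subnK //.
exact: leq_ord.
Qed.

Lemma mxtrace_line_const (c y : M) k x :
  (forall s, \tr ((c + s *: y) ^+ k.+1) = x) -> \tr (c ^+ k * y) = 0.
Proof.
move=> trx; set p := (c%:P + y%:P * 'X : {poly M}) ^+ k.+1.
pose q : {poly F} := \poly_(i < size p) \tr p`_i.
have qE s : q.[s] = x.
  rewrite -(trx s); have -> : (c + s *: y) ^+ k.+1 = mx_curve_eval s p.
    have -> : c + s *: y = mx_curve_eval s (c%:P + y%:P * 'X).
      rewrite /mx_curve_eval hornerD hornerC hornerMX hornerC.
      by rewrite [y * _]mul_mx_scalar.
    rewrite /p; elim: (k.+1) => [|j IH].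
      by rewrite !expr0 -[1 in RHS]/(1%:P) mx_curve_evalC.
    by rewrite !exprS mx_curve_evalM IH.
  rewrite mx_curve_evalE raddf_sum /= horner_poly.
  by apply: eq_bigr => i _; rewrite mxtraceZ mulrC.
have q1 : q`_1 = \tr p`_1.
  rewrite coef_poly; case: ltnP => // /leq_sizeP -> //.
  by rewrite raddf0.
have qx : q = x%:P.
  apply/eqP; rewrite -subr_eq0; apply/negP => /negP/closed_nonrootP[z].
  by rewrite rootE hornerD hornerN hornerC qE subrr eqxx.
have := mxtrace_coef1_line c y k; rewrite -/p -q1 qx coefC /= => /esym/eqP.
by rewrite mulf_eq0 pnatr_eq0 /= => /eqP.
Qed.
End TraceDeriv.

(** * Weight vectors *)

Section Weights.
Variables (F : numClosedFieldType) (n' : nat).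
Local Notation n := n'.+1.
Local Notation M := 'M[F]_n.

(** [x *: (c ^+ m * v)] is the commutator of [t] with [c ^+ m * v], and
    commutators have trace 0. *)
Lemma weight_mxtrace (t c v : M) (x : F) m : c * t = t * c -> x != 0 ->
  t * v - v * t = x *: v -> \tr (c ^+ m * v) = 0.
Proof.
move=> ct x0 tv; suff: x * \tr (c ^+ m * v) = 0.
  by move/eqP; rewrite mulf_eq0 (negbTE x0) => /eqP.
rewrite -mxtraceZ scalerAr -tv mulrBr raddfB /= !mulrA.
have -> : c ^+ m * t = t * c ^+ m by apply/commr_sym/commrX; exact: esym.
by rewrite -(mulrA t) [X in X - _](_ : _ = \tr (c ^+ m * v * t)) ?subrr // mxtrace_mulC.
Qed.

Lemma mxcomm_diag_entry (P v : M) (d : 'rV[F]_n) i j : P \in unitmx ->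
  let t := invmx P *m diag_mx d *m P in
  (P *m (t * v - v * t) *m invmx P) i j =
  (d 0 i - d 0 j) * (P *m v *m invmx P) i j.
Proof.
move=> Pu /=; rewrite -!mulmxE mulmxBr mulmxBl !mulmxA mulmxV // mul1mx mulmxK //.
rewrite -!mulmxA mul_diag_mx !mulmxA mul_mx_diag !mxE mulrBl.
by congr (_ - _); rewrite mulrC.
Qed.

(** [v ^+ k] has weight [k * x], and only finitely many weights occur. *)
Lemma weight_nilpotent (t v : M) (x : F) : diagonalizable t -> x != 0 ->
  t * v - v * t = x *: v -> exists k, v ^+ k = 0.
Proof.
move=> /diagonalizable_conj[P Pu [d tE]] x0 tv.
have tvk k : t * v ^+ k - v ^+ k * t = (k%:R * x) *: v ^+ k.
  elim: k => [|k IH]; first by rewrite expr0 mulr1 mul1r subrr mul0r scale0r.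
  rewrite exprS mulrA; have -> : t * v = x *: v + v * t by rewrite -tv subrK.
  rewrite mulrDl -scalerAl -addrA -!mulrA -mulrBr IH -scalerAr -exprS -scalerDl.
  by rewrite -natr1 mulrDl mul1r addrC.
pose s := [seq d 0 ij.1 - d 0 ij.2 | ij <- enum {: 'I_n * 'I_n}].
(* One multiple of [x] more than there are differences of eigenvalues. *)
pose ks := [seq k%:R * x | k <- iota 0 (size s).+1].
have uks : uniq ks.
  rewrite map_inj_uniq ?iota_uniq // => k l /(mulIf x0) /eqP.
  by rewrite eqr_nat => /eqP.
have /allPn[_ /mapP[k _ ->] ks'] : ~~ all (fun z => z \in s) ks.
  apply/negP => /allP /(uniq_leq_size uks).
  by rewrite size_map size_iota ltnn.
exists k; suff h : P *m v ^+ k *m invmx P = 0.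
  by rewrite -[v ^+ k](mulKmx Pu) -[P *m _](mulmxKV Pu) h mul0mx mulmx0.
apply/matrixP => i j; rewrite [RHS]mxE; apply/eqP.
have := mxcomm_diag_entry (v ^+ k) d i j Pu; rewrite /= -tE tvk.
rewrite -scalemxAr -scalemxAl mxE => /esym/eqP.
rewrite -subr_eq0 -mulrBl mulf_eq0 subr_eq0 => /orP[/eqP dk|//].
by case/negP: ks'; rewrite -dk; apply/mapP; exists (i, j); rewrite ?mem_enum.
Qed.
End Weights.

(** A minor, with rows given by the exponents [e], of the pairing of the powers
    of [x] with matrices [Y] by the trace. It is defined over any ring so that
    it can be evaluated along polynomial curves. *)
Definition det_traces (R : comNzRingType) (m r : nat) (e : 'I_r -> nat)
    (x : 'M[R]_m.+1) (Y : 'I_r -> 'M[R]_m.+1) : R :=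
  \det (\matrix_(i, j) \tr (x ^+ e i * Y j)).

Lemma det_traces_rmorph (R S : comNzRingType) (phi : {rmorphism R -> S})
    (m r : nat) (e : 'I_r -> nat) (x : 'M[R]_m.+1) (Y : 'I_r -> 'M[R]_m.+1) :
  phi (det_traces e x Y) =
  det_traces e (map_mx phi x) (fun j => map_mx phi (Y j)).
Proof.
rewrite /det_traces -det_map_mx; congr (\det _).
apply/matrixP => i j; rewrite !mxE -trace_map_mx.
by rewrite (map_mxM phi (x ^+ e i)) /= rmorphXn.
Qed.

(** Curves through [t] are controlled only at nonzero parameters, after
    division by the parameter. *)
Lemma poly_eq0_punctured (F : numClosedFieldType) (p : {poly F}) :
  (forall s, s != 0 -> p.[s] = 0) -> p = 0.
Proof.
move=> p0; apply/eqP/negPn/negP => pN0.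
have /closed_nonrootP[s] : p * 'X != 0 by rewrite mulf_neq0 ?polyX_eq0.
rewrite rootE hornerMX; have [->|/p0 ->] := eqVneq s 0.
  by rewrite mulr0 eqxx.
by rewrite mul0r eqxx.
Qed.

Lemma eq_det_traces (R : comNzRingType) (m r : nat) (e : 'I_r -> nat)
    (x x' : 'M[R]_m.+1) (Y Y' : 'I_r -> 'M[R]_m.+1) :
  x = x' -> (forall j, Y j = Y' j) -> det_traces e x Y = det_traces e x' Y'.
Proof. by move=> -> /funext ->. Qed.

(** * Maximal tori of a splittable Lie algebra of matrices *)

Section Splittable.
Variables (F : numClosedFieldType) (n' : nat).
Local Notation n := n'.+1.
Local Notation M := 'M[F]_n.
Variable g : M -> Prop.
Hypothesis g0 : g 0.
Hypothesis glin : forall a u v, g u -> g v -> g (a *: u + v).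
Hypothesis gbr : forall u v, g u -> g v -> g (u * v - v * u).
(** Without semisimple parts in [g], the centralizer of a maximal torus could
    contain more than the torus and nilpotent elements. *)
Hypothesis gjordan : forall c, g c -> exists p, let s := horner_mx c p in
  [/\ g s, diagonalizable s & (c - s) ^+ n = 0].

Let gZ a u : g u -> g (a *: u).
Proof. by move=> gu; rewrite -[_ *: _]addr0; exact: glin. Qed.
Let gD u v : g u -> g v -> g (u + v).
Proof. by move=> gu gv; rewrite -[u]scale1r; exact: glin. Qed.

Definition mx_torus (T : {vspace M}) : Prop :=
  [/\ forall a, a \in T -> g a,
      {in T &, forall a b : M, a * b = b * a} &
      {in T, forall a : M, diagonalizable a}].

Definition mx_maximal_torus (T : {vspace M}) : Prop :=
  mx_torus T /\ forall s, g s -> diagonalizable s ->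
    (forall a, a \in T -> s * a = a * s) -> s \in T.

Section OneTorus.
Variable T : {vspace M}.
Hypothesis Tmax : mx_maximal_torus T.

Let Tg a : a \in T -> g a. Proof. by case: Tmax => -[h _ _] _; exact: h. Qed.
Let Tc : {in T &, forall a b : M, a * b = b * a}.
Proof. by case: Tmax => -[_ h _] _. Qed.
Let Td : {in T, forall a : M, diagonalizable a}.
Proof. by case: Tmax => -[_ _ h] _. Qed.

Definition torus_cent (c : M) := g c /\ forall a, a \in T -> c * a = a * c.
Local Notation C := torus_cent.

Let ClinT a u v : C u -> C v -> C (a *: u + v).
Proof.
move=> [gu cu] [gv cv]; split; first exact: glin.
by move=> b bT; rewrite mulrDl mulrDr -scalerAl -scalerAr cu ?cv.
Qed.

Let TC a : a \in T -> C a.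
Proof. by move=> aT; split; [exact: Tg|move=> b bT; exact: Tc]. Qed.

Let CB u v : C u -> C v -> C (u - v).
Proof. by move=> Cu Cv; rewrite addrC -scaleN1r; exact: ClinT. Qed.

(** The semisimple part of [c] is a polynomial in [c], so it commutes with
    [T] and lies in it by maximality. *)
Lemma cent_torus_add_nilpotent c : C c ->
  exists2 a, a \in T & C (c - a) /\ (c - a) ^+ n = 0.
Proof.
move=> [gc cc]; have [p /= [gs ds ns]] := gjordan gc.
exists (horner_mx c p); last first.
  split=> //; apply: CB => //; split=> // a aT.
  by apply: comm_horner_mx; exact: cc.
apply: Tmax.2 => // a aT.
by apply: comm_horner_mx; exact: cc.
Qed.

Definition trace_orthogonal y :=
  forall a m, a \in T -> \tr (a ^+ m * y) = 0.

(** The right-hand side is linear in [y]: the nilpotent elements of the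
    centralizer form a subspace. *)
Lemma cent_nilpotentP y : C y -> (exists k, y ^+ k = 0) <-> trace_orthogonal y.
Proof.
move=> Cy; split=> [[k yk] a m aT|yT].
  apply: (mxtrace_comm_nilpotent _ yk).
  by apply/commr_sym/commrX; exact: Cy.2.
have [a aT [Cya ya]] := cent_torus_add_nilpotent Cy.
suff a0 : a = 0 by exists n; rewrite -ya a0 subr0.
apply: diagonalizable_trace0 => [|m]; first exact: Td.
have := yT a m aT; rewrite -[y in \tr (_ * y)](subrK a) mulrDr raddfD /=.
rewrite (mxtrace_comm_nilpotent _ ya) ?add0r //.
by apply/commr_sym/commrX; exact: Cya.2.
Qed.

Let torth_lin a u v : trace_orthogonal u -> trace_orthogonal v ->
  trace_orthogonal (a *: u + v).
Proof.
move=> uT vT b m bT; rewrite mulrDr -scalerAr raddfD /= mxtraceZ.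
by rewrite uT // vT // mulr0 addr0.
Qed.

(** [c + s *: y] differs from one fixed element of [T] by a commuting nilpotent
    matrix for every [s], so the traces of its powers do not depend on [s];
    differentiate at 0. *)
Lemma cent_nilpotent_trace c y k m :
  C c -> C y -> y ^+ k = 0 -> \tr (c ^+ m * y) = 0.
Proof.
move=> Cc Cy yk; have [a aT [Cca ca]] := cent_torus_add_nilpotent Cc.
apply: (@mxtrace_line_const _ _ _ _ _ (\tr (a ^+ m.+1))) => s.
have Cs : C (s *: y + (c - a)) by exact: ClinT.
have [l sl] : exists l, (s *: y + (c - a)) ^+ l = 0.
  apply/(cent_nilpotentP Cs)/torth_lin.
    by apply/(cent_nilpotentP Cy); exists k.
  by apply/(cent_nilpotentP Cca); exists n.
have -> : c + s *: y = a + (s *: y + (c - a)).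
  by rewrite addrCA [a + _]addrC subrK addrC.
by apply: (mxtrace_exp_add_nilpotent _ _ sl); apply/esym; exact: Cs.2.
Qed.

(** The adjoint action of [t] on all matrices is diagonalizable and preserves
    [g]. *)
Lemma weight_split t y : t \in T -> g y ->
  exists y0, exists2 s : seq (F * M),
    forall q, q \in s -> [/\ q.1 != 0, g q.2 & t * q.2 - q.2 * t = q.1 *: q.2] &
    [/\ g y0, y0 * t = t * y0 & y = y0 + \sum_(q <- s) q.2].
Proof.
move=> tT gy; have /diagonalizable_conj[P Pu [d tE]] := Td tT.
pose A := undup [seq d 0 ij.1 - d 0 ij.2 | ij <- enum {: 'I_n * 'I_n}].
pose e (ij : 'I_n * 'I_n) : M := (P *m y *m invmx P) ij.1 ij.2 *:
  (invmx P *m delta_mx ij.1 ij.2 *m P).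
pose s := [seq (d 0 ij.1 - d 0 ij.2, e ij) | ij <- enum {: 'I_n * 'I_n}].
pose f (v : M) := t * v - v * t.
have yE : y = \sum_(q <- s) q.2.
  rewrite big_map big_enum /= -[y in LHS](mulKmx Pu) -[P *m y](mulmxKV Pu).
  rewrite [X in invmx P *m (X *m P)]matrix_sum_delta pair_big /=.
  rewrite mulmx_suml mulmx_sumr; apply: eq_bigr => ij _.
  by rewrite -scalemxAl -scalemxAr mulmxA.
have [|||||s' s'P s'E] := @eigenvector_split F M g f A s glin g0.
- by move=> b u v; rewrite /f mulrDr mulrDl -scalerAr -scalerAl scalerBr opprD addrACA.
- by move=> u gu; apply: gbr => //; exact: Tg.
- exact: undup_uniq.
- move=> _ /mapP[ij ijE ->] /=; split; first by rewrite mem_undup; apply/mapP; exists ij.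
  rewrite /f /e -scalerAr -scalerAl -scalerBr scalerA mulrC -scalerA.
  congr (_ *: _); rewrite tE -!mulmxE !mulmxA.
  rewrite (mulmxK Pu) (mulmxK Pu).
  have -> : invmx P *m diag_mx d *m delta_mx ij.1 ij.2 =
      d 0 ij.1 *: (invmx P *m delta_mx ij.1 ij.2).
    rewrite -mulmxA scalemxAr; congr (_ *m _); apply/matrixP => i j.
    by rewrite mul_diag_mx !mxE; case: eqP => [->|]; rewrite ?mulr0.
  have -> : invmx P *m delta_mx ij.1 ij.2 *m diag_mx d =
      d 0 ij.2 *: (invmx P *m delta_mx ij.1 ij.2).
    rewrite -mulmxA scalemxAr; congr (_ *m _); apply/matrixP => i j.
    rewrite mul_mx_diag !mxE mulrC; case: (j =P ij.2) => [->//|].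
    by rewrite andbF !mulr0.
  by rewrite -!scalemxAl scalerBl.
- by rewrite -yE.
exists (\sum_(q <- s' | q.1 == 0) q.2), [seq q <- s' | q.1 != 0].
  by move=> q; rewrite mem_filter => /andP[q0 /s'P[_ gq fq]].
split; last by rewrite big_filter [LHS]yE [LHS]s'E;
    exact: (bigID (fun q : F * M => q.1 == 0)).
  rewrite big_seq_cond; apply: (big_ind g) => //.
  by move=> q /andP[/s'P[]].
rewrite mulr_sumr mulr_suml [LHS]big_seq_cond [RHS]big_seq_cond; apply: eq_bigr => q.
move=> /andP[/s'P[_ _ fq] /eqP q0].
by apply/esym/eqP; rewrite -subr_eq0 -/(f q.2) fq q0 scale0r.
Qed.

(** The families [Y] range over [g] and not over a fixed basis, which makes the
    condition stable under the conjugations that preserve [g]. *)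
Definition trace_degenerate (r : nat) (e : 'I_r -> nat) (x : M) :=
  g x /\ forall Y : 'I_r -> M, (forall j, g (Y j)) -> det_traces e x Y = 0.

(** Against powers of [c], weight vectors of nonzero weight and nilpotent
    elements of the centralizer have trace 0, so only the components in [T] of
    the [Y j] matter, and more than [\dim T] of them are linearly dependent. *)
Lemma cent_trace_degenerate (r : nat) (e : 'I_r -> nat) t c :
    (\dim T < r)%N -> t \in T ->
    (forall a, a \in T -> exists p, a = horner_mx t p) ->
  C c -> trace_degenerate e c.
Proof.
move=> ltTr tT tgen Cc; split=> [|Y Yg]; first exact: Cc.1.
have /choice[y0 y0P] j : exists y0, C y0 /\ forall m, \tr (c ^+ m * Y j) = \tr (c ^+ m * y0).
  have [y0 [s sP [gy0 ty0 YE]]] := weight_split tT (Yg j).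
  exists y0; split=> [|m].
    split=> // a /tgen[p ->]; apply/esym/comm_horner_mx/esym; exact: ty0.
  rewrite YE mulrDr raddfD /= mulr_sumr raddf_sum big_seq big1 ?addr0 // => q.
  move=> /sP[q0 _ qw]; apply: (weight_mxtrace _ _ q0 qw); exact: Cc.2.
have /choice[a aP] j : exists a, a \in T /\ C (y0 j - a) /\ (y0 j - a) ^+ n = 0.
  by have [a aT aP] := cent_torus_add_nilpotent (y0P j).1; exists a.
have [x x0 xa] : exists2 x : 'rV[F]_r, x != 0 & \sum_j x 0 j *: a j = 0.
  (* More rows than columns, so the rows are dependent. *)
  pose A := \matrix_(j < r, k < \dim T) coord (vbasis T) k (a j).
  have : kermx A != 0.
    rewrite -mxrank_eq0 mxrank_ker subn_eq0 -ltnNge.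
    exact: leq_ltn_trans (rank_leq_col A) _.
  rewrite -nz_row_eq0 => x0; exists (nz_row (kermx A)) => //.
  have /sub_kermxP xA := nz_row_sub (kermx A).
  rewrite (eq_bigr (fun j => \sum_k (nz_row (kermx A) 0 j * A j k) *: (vbasis T)`_k)).
    rewrite exchange_big big1 // => k _; rewrite -scaler_suml.
    by move/rowP/(_ k): xA; rewrite !mxE => ->; rewrite scale0r.
  move=> j _; rewrite [in LHS](coord_vbasis (aP j).1) scaler_sumr.
  by apply: eq_bigr => k _; rewrite mxE scalerA.
pose y := \sum_j x 0 j *: y0 j.
have Cy : C y.
  rewrite /y; apply: (big_ind C) => [|u v Cu Cv|j _]; first exact/TC/mem0v.
    by rewrite -[u]scale1r; exact: ClinT.
  by rewrite -[_ *: _]addr0; apply: ClinT; [exact: (y0P j).1|exact/TC/mem0v].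
have [k yk] : exists k, y ^+ k = 0.
  apply/(cent_nilpotentP Cy).
  have -> : y = \sum_j x 0 j *: (y0 j - a j).
    under eq_bigr do rewrite scalerBr.
    by rewrite sumrB xa subr0.
  apply: (big_ind trace_orthogonal) => [b m _|u v uo vo|j _].
  - by rewrite mulr0 raddf0.
  - by rewrite -[u]scale1r; exact: torth_lin.
  rewrite -[_ *: _]addr0; apply: torth_lin; last by move=> b m _; rewrite mulr0 raddf0.
  by apply/(cent_nilpotentP (aP j).2.1); exists n; exact: (aP j).2.2.
apply/eqP; rewrite /det_traces -det_tr; apply/det0P; exists x => //.
apply/rowP => i; rewrite !mxE -[RHS](cent_nilpotent_trace (e i) Cc Cy yk).
rewrite /y mulr_sumr raddf_sum; apply: eq_bigr => j _.
by rewrite !mxE (y0P j).2 -scalerAr [RHS]/= mxtraceZ.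
Qed.

End OneTorus.
Local Notation ev := mx_curve_eval.

Lemma exp_curve_conj_mem v m s Y : g v -> v ^+ m = 0 -> g Y ->
  g (ev s (exp_curve (- v) m) * Y * ev s (exp_curve v m)).
Proof.
move=> gv vm gY; rewrite -(mx_curve_evalC s Y) -!mx_curve_evalM mx_curve_evalE.
apply: (big_ind g) => [|a b ga gb|i _] //; first exact: gD.
apply: gZ; apply: exp_curve_conj_coef => // w gw; exact: gbr.
Qed.

(** The traces are invariant under conjugation, and conjugation permutes the
    families [Y] in [g]. *)
Lemma exp_curve_conj_degenerate (r : nat) (e : 'I_r -> nat) v m s x :
  g v -> v ^+ m = 0 -> trace_degenerate e x ->
  trace_degenerate e (ev s (exp_curve v m) * x * ev s (exp_curve (- v) m)).
Proof.
move=> gv vm [gx xdeg]; split=> [|Y gY].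
  rewrite -{1}[v]opprK; apply: exp_curve_conj_mem => //.
    by rewrite -scaleN1r; exact: gZ.
  by rewrite exprNn vm mulr0.
pose E := ev s (exp_curve v m); pose E' := ev s (exp_curve (- v) m).
have E'E : E' * E = 1.
  by rewrite /E /E' -mx_curve_evalM exp_curve_inv // -[1]/(1%:P) mx_curve_evalC.
rewrite -(xdeg (fun j => E' * Y j * E)) => [|j]; last exact: exp_curve_conj_mem.
rewrite /det_traces; congr (\det _); apply/matrixP => i j; rewrite !mxE.
have -> : (E * x * E') ^+ e i = E * x ^+ e i * E'.
  elim: (e i) => [|k IH]; last first.
    by rewrite exprS IH -!mulrA (mulrA E') E'E mul1r exprS !mulrA.
  by rewrite !expr0 mulr1; apply/esym/mulmx1C.
by rewrite -!mulrA -mulmxE mxtrace_mulC mulmxE !mulrA.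
Qed.

Definition degenerate_tangent (r : nat) (e : 'I_r -> nat) (t y : M) :=
  exists gamma : {poly M}, [/\ gamma`_0 = t, gamma`_1 = y &
    forall s, trace_degenerate e (ev s gamma)].

Lemma degenerate_tangent_bracket (r : nat) (e : 'I_r -> nat) t y v m :
  g v -> v ^+ m = 0 -> degenerate_tangent e t y ->
  degenerate_tangent e t (y + (v * t - t * v)).
Proof.
move=> gv vm [gamma [g_0 g_1 gdeg]].
have vNm : (- v) ^+ m = 0 by rewrite exprNn vm mulr0.
exists (exp_curve v m * gamma * exp_curve (- v) m); split=> [||s].
- by rewrite !coefM !big_ord1 /= coefM big_ord1 !coef_exp_curve // g_0 fact0 invr1
    !expr0 !scale1r mul1r mulr1.
- rewrite coefM !big_ord_recl big_ord0 /= /bump /= !coefM !big_ord_recl !big_ord0 /=.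
  rewrite /bump /= !coef_exp_curve // g_0 g_1 fact0 factS fact0 invr1 !expr0 !expr1.
  by rewrite !scale1r !mul1r !mulr1 mulrN !addr0 addrC addrA.
by rewrite !mx_curve_evalM; exact: exp_curve_conj_degenerate.
Qed.

(** The centralizer directions are straight lines; each weight direction is
    obtained by conjugating with the exponential of a multiple of the weight
    vector, which is nilpotent. *)
Lemma degenerate_tangent_all T (r : nat) (e : 'I_r -> nat) t y :
    mx_maximal_torus T -> (\dim T < r)%N -> t \in T ->
    (forall a, a \in T -> exists p, a = horner_mx t p) ->
  g y -> degenerate_tangent e t y.
Proof.
move=> Tmax ltTr tT tgen gy.
have [y0 [s sP [gy0 ty0 ->]]] := weight_split Tmax tT gy.
have tC : torus_cent T t.
  split; first by case: Tmax => -[Tg _ _] _; exact: Tg.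
  by move=> a aT; case: Tmax => -[_ Tc _] _; exact: Tc.
have y0C : torus_cent T y0.
  by split=> // a /tgen[p ->]; apply/esym/comm_horner_mx/esym; exact: ty0.
elim: s sP => [|[x v] s IH] sP.
  rewrite big_nil addr0; exists (t%:P + y0%:P * 'X); split=> [||c].
  - by rewrite coefD coefC coefMX /= addr0.
  - by rewrite coefD coefC coefMX coefC /= add0r.
  have -> : ev c (t%:P + y0%:P * 'X) = c *: y0 + t.
    rewrite /mx_curve_eval hornerD hornerC hornerMX hornerC addrC.
    by rewrite [y0 * _]mul_mx_scalar.
  apply: (cent_trace_degenerate Tmax e ltTr tT tgen).
  split; first by apply: glin; [exact: gy0|exact: tC.1].
  move=> a aT; rewrite mulrDl mulrDr -scalerAl -scalerAr.
  by rewrite y0C.2 // tC.2.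
have /= [x0 gv tv] := sP (x, v) (mem_head _ _).
have [|k vk] := weight_nilpotent _ x0 tv.
  by case: Tmax => -[_ _ Td] _; exact: Td.
rewrite big_cons /= addrCA.
(* The bracket with [t] of this multiple of [v] is [v] itself. *)
have -> : v = (- x^-1 *: v) * t - t * (- x^-1 *: v).
  rewrite -scalerAl -scalerAr -scalerBr -[v * t - _]opprB tv.
  by rewrite scaleNr scalerN opprK scalerA mulVf // scale1r.
rewrite addrC; apply: (@degenerate_tangent_bracket _ _ _ _ _ k).
- exact: gZ.
- by rewrite exprZn vk scaler0.
by apply: IH => q qs; apply: sP; rewrite inE qs orbT.
Qed.
(** Expand along lines through [t]: let [k] be the least degree of a nonzero
    coefficient, at a direction [y]. Along a degenerate curve with tangent [y]
    the coefficient of degree [k] is unaffected by the higher terms of the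
    curve, yet the whole expansion vanishes. *)
Lemma det_traces_vanish (r : nat) (e : 'I_r -> nat) (t : M) Y :
    g t -> (forall j, g (Y j)) ->
    (forall y, g y -> degenerate_tangent e t y) ->
  forall y, g y -> det_traces e (t + y) Y = 0.
Proof.
move=> gt gY tangent.
pose P (u : M) : {poly F} := det_traces e
  (map_mx polyC t + 'X *: map_mx polyC u) (fun j => map_mx polyC (Y j)).
have mapC (s : F) (u : M) : map_mx (horner_eval s) (map_mx polyC u) = u.
  by apply/matrixP => i j; rewrite !mxE /= /horner_eval hornerC.
have PE s u : (P u).[s] = det_traces e (t + s *: u) Y.
  rewrite -[LHS]/(horner_eval s (P u)) /P (det_traces_rmorph (horner_eval s)).
  apply: eq_det_traces => [|j]; last by rewrite mapC.
    rewrite map_mxD map_mxZ !mapC; congr (_ + _ *: _).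
    exact: hornerX.
move=> y1 gy1; rewrite -[y1]scale1r -PE.
suff P0 u k : g u -> (P u)`_k = 0.
  suff -> : P y1 = 0 by rewrite horner0.
  by apply/polyP => k; rewrite coef0 P0.
elim/ltn_ind: k u => k IH y gy.
have [gamma [gamma0 gamma1 gdeg]] := tangent y gy.
(* The direction of the curve: gamma(s) = t + s u(s). *)
pose u : 'M[{poly F}]_n :=
  \matrix_(i, j) \poly_(l < size gamma) (gamma`_l.+1 i j).
have uE (s : F) : t + s *: map_mx (horner_eval s) u = ev s gamma.
  rewrite mx_curve_evalE.
  have -> : \sum_(l < size gamma) s ^+ l *: gamma`_l =
      \sum_(l < (size gamma).+1) s ^+ l *: gamma`_l.
    by rewrite big_ord_recr /= nth_default // scaler0 addr0.
  rewrite big_ord_recl expr0 scale1r gamma0; congr (_ + _).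
  apply/matrixP => i j; rewrite !mxE /horner_eval horner_poly mulr_sumr summxE.
  by apply: eq_bigr => l _; rewrite mxE exprS -mulrA [s ^+ l * _]mulrC.
have u0 : map_mx (horner_eval 0) u = y.
  apply/matrixP => i j; rewrite !mxE /horner_eval horner_coef0 coef_poly gamma1.
  case: posnP => // /eqP; rewrite size_poly_eq0 => /eqP g00.
  by rewrite -gamma1 g00 coef0 mxE.
have gu (s : F) : s != 0 -> g (map_mx (horner_eval s) u).
  move=> s0; have [gs _] := gdeg s.
  have -> : map_mx (horner_eval s) u = s^-1 *: (ev s gamma - t).
    by rewrite -uE addrC addKr scalerA mulVf // scale1r.
  rewrite -[_ *: _]addr0; apply: glin => //.
  by rewrite addrC -scaleN1r; exact: glin.
(* Two parameters: the outer one measures the distance from [t] along a line,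
   the inner one the position on the curve, on which the direction [u] depends. *)
pose H : {poly {poly F}} := det_traces e
  (map_mx (polyC \o polyC) t + 'X *: map_mx polyC u)
  (fun j => map_mx (polyC \o polyC) (Y j)).
have HE (s : F) : map_poly (horner_eval s) H = P (map_mx (horner_eval s) u).
  pose phi : {rmorphism {poly {poly F}} -> {poly F}} := map_poly (horner_eval s).
  rewrite -[LHS]/(phi H) /H (det_traces_rmorph phi).
  apply: eq_det_traces => [|l].
    rewrite map_mxD map_mxZ /= map_polyX; congr (_ + _ *: _).
      by apply/matrixP => i j; rewrite !mxE /= map_polyC /= /horner_eval hornerC.
    by apply/matrixP => i j; rewrite !mxE /= map_polyC /= /horner_eval.
  by apply/matrixP => i j; rewrite !mxE /= map_polyC /= /horner_eval hornerC.
have HcE (s : F) l : (H`_l).[s] = (P (map_mx (horner_eval s) u))`_l.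
  by rewrite -HE coef_map.
have Hlow l : (l < k)%N -> H`_l = 0.
  move=> lk; apply: poly_eq0_punctured => s s0; rewrite HcE.
  by apply: IH => //; exact: gu.
(* The coefficients of [H] below [k] vanish, and [Q] is the value of [H]
   divided by the power [k] of the parameter, on the diagonal where both
   parameters agree. *)
pose Q := \sum_(l < (size H).+1) H`_(k + l) * 'X^l.
have QE (s : F) : s ^+ k * Q.[s] = 0.
  have : (P (map_mx (horner_eval s) u)).[s] = 0.
    by rewrite PE uE; apply: (gdeg s).2.
  rewrite -HE (@horner_coef_wide _ (k + (size H).+1)); last first.
    apply: (leq_trans (size_poly _ _)); apply: (leq_trans (leqnSn _)).
    exact: leq_addl.
  rewrite big_split_ord /= big1 ?add0r => [|l _]; last first.
    by rewrite coef_map /= Hlow // /horner_eval horner0 mul0r.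
  move=> <-; rewrite /Q horner_sum mulr_sumr; apply: eq_bigr => l _.
  by rewrite hornerM hornerXn coef_map /= /horner_eval exprD mulrCA mulrA.
have Q0 : Q = 0.
  apply: poly_eq0_punctured => s s0.
  by have /eqP := QE s; rewrite mulf_eq0 expf_eq0 (negbTE s0) andbF => /eqP.
have := congr1 (fun q : {poly F} => q.[0]) Q0.
rewrite /Q big_ord_recl expr0 mulr1 addn0 hornerD horner_sum big1 => [|l _].
  by rewrite horner0 addr0 HcE u0.
by rewrite hornerM hornerXn expr0n /= mulr0.
Qed.

(** A combination [y] of basis vectors orthogonal to all powers of a generator
    [t] is a polynomial in [t], so all the powers of [y] have trace 0. *)
Lemma torus_det_traces_neq0 T : mx_torus T ->
  exists e : 'I_(\dim T) -> nat, exists2 t, t \in T &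
    det_traces e t (fun j : 'I_(\dim T) => (vbasis T)`_j) != 0.
Proof.
move=> [Tg Tc Td]; have [t tT tgen] := torus_generator Tc Td.
pose J := \matrix_(i < n, j < \dim T) \tr (t ^+ i * (vbasis T)`_j).
have Jfull : row_full J.
  rewrite /row_full -mxrank_tr; apply: inj_row_free => x xJ.
  pose y := \sum_j x 0 j *: (vbasis T)`_j.
  have yT : y \in T.
    apply: memv_suml => j _; apply: memvZ; apply: vbasis_mem.
    by rewrite mem_nth // size_tuple.
  have ytr p : \tr (horner_mx t p * y) = 0.
    apply: mxtrace_horner_lt => m ltmn; move/rowP/(_ (Ordinal ltmn)): xJ.
    rewrite !mxE => <-; rewrite /y mulr_sumr raddf_sum; apply: eq_bigr => j _.
    by rewrite !mxE -scalerAr [LHS]/= mxtraceZ.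
  have y0 : y = 0.
    apply: diagonalizable_trace0; first exact: Td.
    have [p yE] := tgen y yT; move=> m; rewrite {1}yE -rmorphXn; exact: ytr.
  have /freeP xfree := basis_free (vbasisP T).
  by apply/rowP => j; rewrite mxE; apply: (xfree (fun j => x 0 j)).
exists (fun i => fullrankfun Jfull i), t => //.
have := fullrowsub_unit Jfull; rewrite unitmxE unitfE; congr (\det _ != 0).
by apply/matrixP => i j; rewrite !mxE.
Qed.
(** If [T1] were larger, some minor of size [\dim T1] would be nonzero at a point
    of [T1], while all of them vanish on [g]. *)
Theorem mx_maximal_torus_dim_le T1 T2 :
  mx_torus T1 -> mx_maximal_torus T2 -> (\dim T1 <= \dim T2)%N.
Proof.
move=> T1t T2m; rewrite leqNgt; apply/negP => lt21.
have [e [t1 t1T /eqP[]]] := torus_det_traces_neq0 T1t.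
have [[T2g T2c T2d] _] := T2m.
have [t tT tgen] := torus_generator T2c T2d.
have T1g : forall a, a \in T1 -> g a by case: T1t.
have -> : t1 = t + (t1 - t) by rewrite addrC subrK.
apply: det_traces_vanish.
- exact: T2g.
- by move=> j; apply/T1g/vbasis_mem; rewrite mem_nth // size_tuple.
- move=> y gy; exact: (degenerate_tangent_all e T2m lt21 tT tgen gy).
rewrite addrC -scaleN1r; apply: glin; [exact: T2g|exact: T1g].
Qed.
End Splittable.

(** * Bases and linear maps *)

Section LinearMaps.
Variables (K : fieldType) (V W : lmodType K).
Implicit Types (f g : V -> W).

Lemma lin0 f : linear f -> f 0 = 0.
Proof. by move=> fl; have := fl (-1) 0 0; rewrite scaler0 addr0 scaleN1r addNr. Qed.

Lemma linD f : linear f -> {morph f : u v / u + v}.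
Proof. by move=> fl u v; have := fl 1 u v; rewrite !scale1r. Qed.

Lemma linZ f : linear f -> forall a u, f (a *: u) = a *: f u.
Proof. by move=> fl a u; have := fl a u 0; rewrite (lin0 fl) !addr0. Qed.

Lemma linB f : linear f -> {morph f : u v / u - v}.
Proof. by move=> fl u v; rewrite linD // -scaleN1r linZ // scaleN1r. Qed.

Lemma lin_sum f (I : Type) (r : seq I) (h : I -> V) : linear f ->
  f (\sum_(i <- r) h i) = \sum_(i <- r) f (h i).
Proof. by move=> fl; apply: big_morph; [exact: linD|exact: lin0]. Qed.

Lemma subspaceD (U : set V) u v : subspace U -> U u -> U v -> U (u + v).
Proof. by move=> [_ UP] Uu Uv; rewrite -[u]scale1r; exact: UP. Qed.

Lemma subspaceZ (U : set V) a u : subspace U -> U u -> U (a *: u).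
Proof. by move=> [U0 UP] Uu; rewrite -[_ *: _]addr0; exact: UP. Qed.

Lemma subspaceB (U : set V) u v : subspace U -> U u -> U v -> U (u - v).
Proof. by move=> US Uu Uv; rewrite -scaleN1r; apply: subspaceD => //; apply: subspaceZ. Qed.

Lemma subspace_sum (U : set V) (I : eqType) (r : seq I) (h : I -> V) :
  subspace U -> (forall i, i \in r -> U (h i)) -> U (\sum_(i <- r) h i).
Proof.
move=> US Uh; rewrite big_seq; apply: (big_ind U) => //; first exact: US.1.
by move=> *; apply: subspaceD.
Qed.

Lemma eq_on_lspan f g (B : set V) : linear f -> linear g ->
  (forall b, B b -> f b = g b) -> forall v, lspan B v -> f v = g v.
Proof.
move=> fl gl fg; apply: lspan_min => //; split; first by rewrite !lin0.
by move=> a u v fu fv; rewrite fl gl fu fv.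
Qed.

Lemma eq_on_basis f g (B : set V) : is_basis setT B -> linear f -> linear g ->
  (forall b, B b -> f b = g b) -> f = g.
Proof.
move=> [_ _ Bs] fl gl fg; apply/funext => v.
by apply: (eq_on_lspan fl gl fg); exact: Bs.
Qed.

Lemma lin_indep_pairs (B : set V) (s : seq (K * V)) f :
  lin_indep B -> (forall p, p \in s -> B p.2) ->
  \sum_(p <- s) p.1 *: p.2 = 0 -> \sum_(p <- s) p.1 *: f p.2 = 0.
Proof.
move=> Bi sB s0; pose vs := undup [seq p.2 | p <- s].
pose c v := \sum_(p <- s | p.2 == v) p.1.
have collect (X : lmodType K) (h : V -> X) :
    \sum_(p <- s) p.1 *: h p.2 = \sum_(v <- vs) c v *: h v.
  under [RHS]eq_bigr do rewrite scaler_suml big_mkcond.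
  rewrite exchange_big /= !big_seq; apply: eq_bigr => p ps.
  have pvs : p.2 \in vs by rewrite /vs mem_undup; apply/mapP; exists p.
  rewrite (bigD1_seq p.2 pvs (undup_uniq _)) /= eqxx.
  rewrite big1 ?addr0 // => v; rewrite eq_sym => /negbTE h'.
  by rewrite h'.
rewrite (collect _ f) big_seq big1 // => v vvs.
have vsB w : w \in vs -> B w.
  by rewrite /vs mem_undup => /mapP[p /sB Bp ->].
have vs0 : \sum_(w <- vs) c w *: w = 0 by rewrite -(collect _ id).
by rewrite (Bi vs c (undup_uniq _) vsB vs0 v vvs) scale0r.
Qed.

(** The value at a vector is read off any of its expansions; independence
    ([lin_indep_pairs]) makes it well defined. *)
Lemma basis_extension (B : set V) (h : V -> W) : is_basis setT B ->
  exists2 f, linear f & forall b, B b -> f b = h b.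
Proof.
move=> [_ Bi Bs].
have /choice[s sP] v : exists s : seq (K * V),
    (forall p, p \in s -> B p.2) /\ v = \sum_(p <- s) p.1 *: p.2.
  by have [//|s sB ->] := Bs v; exists s.
pose f v := \sum_(p <- s v) p.1 *: h p.2.
have fE v (t : seq (K * V)) : (forall p, p \in t -> B p.2) ->
    v = \sum_(p <- t) p.1 *: p.2 -> f v = \sum_(p <- t) p.1 *: h p.2.
  move=> tB vE; apply/eqP; rewrite -subr_eq0 /f.
  pose t' := [seq (- p.1, p.2) | p <- t].
  have t'E (X : lmodType K) (k : V -> X) :
      - (\sum_(p <- t) p.1 *: k p.2) = \sum_(p <- t') p.1 *: k p.2.
    by rewrite big_map -sumrN; apply: eq_bigr => p _; rewrite scaleNr.
  rewrite (t'E _ h) -big_cat; apply/eqP/(lin_indep_pairs _ Bi).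
    by move=> p; rewrite mem_cat => /orP[/(sP v).1//|/mapP[q /tB Bq ->]].
  by rewrite big_cat /= -(t'E _ id) -(sP v).2 -vE subrr.
exists f.
  move=> a u v; rewrite (fE _ ([seq (a * p.1, p.2) | p <- s u] ++ s v)).
  - rewrite big_cat big_map scaler_sumr; congr (_ + _).
    by apply: eq_bigr => p _; rewrite scalerA.
  - move=> p; rewrite mem_cat => /orP[/mapP[q /(sP u).1 Bq ->]//|].
    exact: (sP v).1.
  rewrite big_cat big_map {1}(sP u).2 {1}(sP v).2 scaler_sumr; congr (_ + _).
  by apply: eq_bigr => p _; rewrite scalerA.
move=> b Bb; rewrite (fE b [:: (1, b)]) ?big_seq1 ?scale1r //.
by move=> p; rewrite inE => /eqP ->.
Qed.

End LinearMaps.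

Section Families.
Variables (K : fieldType) (V : lmodType K).

Lemma free_family_basis (U : set V) (d : nat) (X : 'I_d -> V) :
    (forall i, U (X i)) ->
    (forall c : 'I_d -> K, \sum_i c i *: X i = 0 -> forall i, c i = 0) ->
    (forall u, U u -> exists c : 'I_d -> K, u = \sum_i c i *: X i) ->
  is_basis U (range X) /\ injective X.
Proof.
move=> UX Xfree Xspan.
have Xinj : injective X.
  move=> i j Xij; apply/eqP/negPn/negP => ij.
  have : 1 = 0 :> K.
    rewrite -(Xfree (fun k => (k == i)%:R - (k == j)%:R) _ i).
      by rewrite eqxx (negbTE ij) subr0.
    under eq_bigr do rewrite scalerBl.
    rewrite sumrB (bigD1 i) //= eqxx scale1r big1 ?addr0; last first.
      by move=> k /negbTE->; rewrite scale0r.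
    rewrite (bigD1 j) //= eqxx scale1r big1 ?addr0 ?Xij ?subrr //.
    by move=> k /negbTE->; rewrite scale0r.
  by move/eqP; rewrite oner_eq0.
split=> //; split.
- by move=> _ [i _ <-]; exact: UX.
- move=> s c us sX s0 v vs; have [i _ Xv] := sX v vs.
  (* The relation on [s], reindexed by the family and extended by 0. *)
  pose c' j := if X j \in s then c (X j) else 0.
  have : c' i = 0; last by rewrite /c' Xv vs.
  apply: Xfree; apply: etrans s0.
  have -> : \sum_(v <- s) c v *: v = \sum_(j | X j \in s) c (X j) *: X j.
    rewrite -[RHS]big_filter -(big_map X xpredT (fun v => c v *: v)).
    apply: perm_big; apply: uniq_perm => //.
      by rewrite map_inj_uniq // filter_uniq // index_enum_uniq.
    move=> w; apply/idP/mapP => [ws|[j + ->]]; last first.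
      by rewrite mem_filter => /andP[].
    have [j _ Xj] := sX w ws; exists j => //.
    by rewrite mem_filter mem_index_enum Xj ws.
  rewrite [RHS]big_mkcond /=. apply: eq_bigr => j _.
  by rewrite /c'; case: ifP => _ //; rewrite scale0r.
move=> u /Xspan[c ->]; exists [seq (c i, X i) | i <- index_enum 'I_d].
  by move=> p /mapP[i _ ->]; exists i.
by rewrite big_map.
Qed.

Lemma finite_dim_coordinates : finite_dim V ->
  exists d (X : 'I_d -> V) (crd : V -> 'rV[K]_d),
    [/\ linear crd, forall v, v = \sum_i crd v 0 i *: X i &
        forall x : 'rV_d, crd (\sum_i x 0 i *: X i) = x].
Proof.
move=> [B [_ Bi Bs] /finite_seqP[s0 BE]]; pose s := undup s0.
have sB v : (v \in s) <-> B v by rewrite /s mem_undup BE.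
pose X (i : 'I_(size s)) := s`_i.
have Xfree (c : 'I_(size s) -> K) : \sum_i c i *: X i = 0 -> forall i, c i = 0.
  move=> c0 i; pose c' v := oapp c 0 (insub (index v s)).
  have c'E j : c' (X j) = c j.
    by rewrite /c' /X index_uniq ?undup_uniq // valK.
  rewrite -c'E; apply: (Bi s) => [|v /sB//||]; first exact: undup_uniq.
    rewrite (big_nth 0) big_mkord -[RHS]c0; apply: eq_bigr => j _.
    by rewrite -/(X j) c'E.
  exact: mem_nth.
have Xinj : injective X.
  by move=> i j /eqP; rewrite nth_uniq ?undup_uniq // => /eqP/val_inj.
have /choice[crd crdP] v : exists x : 'rV[K]_(size s), v = \sum_i x 0 i *: X i.
  have [//|t tB ->] := Bs v.
  exists (\row_i \sum_(p <- t | p.2 == X i) p.1).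
  under [RHS]eq_bigr do rewrite mxE scaler_suml big_mkcond.
  rewrite exchange_big /= !big_seq; apply: eq_bigr => p /tB/sB ps.
  have ip : (index p.2 s < size s)%N by rewrite index_mem.
  have XE : X (Ordinal ip) = p.2 by rewrite /X nth_index.
  rewrite (bigD1 (Ordinal ip)) //= XE eqxx big1 ?addr0 // => i ii.
  rewrite -XE; case: eqP => // /Xinj ip_i.
  by rewrite ip_i eqxx in ii.
exists (size s), X, crd.
have crdK (x : 'rV_(size s)) : crd (\sum_i x 0 i *: X i) = x.
  apply/rowP => i; apply/eqP; rewrite -subr_eq0; apply/eqP.
  apply: (Xfree (fun i => crd (\sum_i x 0 i *: X i) 0 i - x 0 i)).
  by under eq_bigr do rewrite scalerBl; rewrite sumrB -crdP subrr.
split=> // a u v; rewrite -[RHS]crdK; congr crd.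
rewrite [in LHS](crdP u) [in LHS](crdP v) scaler_sumr -big_split /=.
by apply: eq_bigr => i _; rewrite scalerA -scalerDl !mxE.
Qed.

End Families.

Section VectorSpaces.
Variables (K : fieldType) (V : vectType K).

Lemma subspace_vspace (U : set V) : subspace U ->
  exists S : {vspace V}, forall v, v \in S <-> U v.
Proof.
move=> US; pose P d := `[< exists2 S : {vspace V}, \dim S = d & forall v, v \in S -> U v >].
have P0 : exists d, P d.
  exists 0; apply/asboolP; exists 0%VS; first exact: dimv0.
  by move=> v; rewrite memv0 => /eqP->; exact: US.1.
have Pub d : P d -> (d <= \dim {:V})%N.
  by move=> /asboolP[S <- _]; exact/dimvS/subvf.
case: (ex_maxnP P0 Pub) => d /asboolP[S Sd SU] dmax.
exists S => v; split=> [/SU//|Uv]; apply: contraT => vS.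
have /dmax : P (\dim (S + <[v]>)); last first.
  rewrite leqNgt -Sd => /negP[]; rewrite ltn_neqAle dimvS ?addvSl // andbT.
  apply: contra vS => /eqP dE.
  have /eqP -> : S == (S + <[v]>)%VS by rewrite eqEdim addvSl dE leqnn.
  by rewrite memvE addvSr.
apply/asboolP; exists (S + <[v]>)%VS => // w /memv_addP[u uS [x /vlineP[a ->] ->]].
by apply: subspaceD => //; [exact: SU|exact: subspaceZ].
Qed.

Lemma decreasing_subspaces_stable (U : nat -> set V) :
  (forall k, subspace (U k)) -> (forall k, U k.+1 `<=` U k) ->
  exists k0, forall k, (k0 <= k)%N -> U k = U k0.
Proof.
move=> US Udec; have /choice[S SP] k := subspace_vspace (US k).
have P0 : exists d, `[< exists k, \dim (S k) = d >].
  by exists (\dim (S 0)); apply/asboolP; exists 0.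
case: (ex_minnP P0) => d /asboolP[k0 k0d] dmin; exists k0 => k.
elim: k => [|k IH]; first by rewrite leqn0 => /eqP->.
rewrite leq_eqVlt => /predU1P[<-//|]; rewrite ltnS => /IH Uk.
have sub : (S k.+1 <= S k0)%VS.
  by apply/subvP => v /SP/Udec; rewrite Uk => /SP.
have /eqP SE : S k.+1 == S k0.
  by rewrite eqEdim sub k0d dmin //; apply/asboolP; exists k.+1.
by apply/seteqP; split => v; [move/SP; rewrite SE => /SP|move/SP; rewrite -SE => /SP].
Qed.

(** Dimensions of infinite-dimensional ambient spaces are compared through an
    injective linear map to a vector space with a computed dimension. *)
Lemma pullback_basis (V' : lmodType K) (U : set V') (f : V' -> V)
    (S : {vspace V}) : subspace U -> linear f ->
    (forall u, U u -> f u = 0 -> u = 0) ->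
    (forall v, v \in S <-> exists2 u, U u & f u = v) ->
  exists2 B, is_basis U B & (B #= `I_(\dim S))%card.
Proof.
move=> US fl finj fim.
have /choice[X XP] (i : 'I_(\dim S)) : exists u, U u /\ f u = (vbasis S)`_i.
  have /fim[u Uu fu] : (vbasis S)`_i \in S.
    by apply: vbasis_mem; rewrite mem_nth // size_tuple.
  by exists u.
have sumU (c : 'I_(\dim S) -> K) : U (\sum_i c i *: X i).
  by apply: subspace_sum => // i _; apply: subspaceZ => //; exact: (XP i).1.
have fsum (c : 'I_(\dim S) -> K) :
    f (\sum_i c i *: X i) = \sum_i c i *: (vbasis S)`_i.
  by rewrite lin_sum //; apply: eq_bigr => i _; rewrite linZ // (XP i).2.
have [||| Xb Xinj] := @free_family_basis _ _ U _ X.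
- by move=> i; exact: (XP i).1.
- move=> c c0; have /freeP := basis_free (vbasisP S); apply.
  by rewrite -fsum c0 lin0.
- move=> u Uu; have fuS : f u \in S by apply/fim; exists u.
  exists (fun i => coord (vbasis S) i (f u)); apply/eqP.
  rewrite -subr_eq0; apply/eqP; apply: finj; first exact: subspaceB.
  by rewrite linB // fsum -coord_vbasis ?subrr.
exists (range X) => //; apply: (card_eq_trans (inj_card_eq _)).
  by move=> i j _ _; exact: Xinj.
by apply: card_esym; exact: card_II.
Qed.
End VectorSpaces.

(** * The lower central series and derivations modulo its terms *)

Section LieBasics.
Variables (K : fieldType) (L : lieAlgType K).
Implicit Types (x y z : L).

Lemma lieDl z : {morph (fun x => lie x z) : x y / x + y}.
Proof. by move=> x y /=; have := lie_linearl z 1 x y; rewrite !scale1r. Qed.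
Lemma lieDr z : {morph (fun x => lie z x) : x y / x + y}.
Proof. by move=> x y /=; have := lie_linearr z 1 x y; rewrite !scale1r. Qed.
Lemma lie0l z : lie 0 z = 0.
Proof. by apply: (addrI (lie 0 z)); rewrite -lieDl !addr0. Qed.
Lemma lie0r z : lie z 0 = 0.
Proof. by apply: (addrI (lie z 0)); rewrite -lieDr !addr0. Qed.
Lemma lieZl z a x : lie (a *: x) z = a *: lie x z.
Proof. by have := lie_linearl z a x 0; rewrite lie0l !addr0. Qed.

(** Jacobi: [x, [u, v]] = [[x, u], v] - [[x, v], u]. *)
Lemma lie_lcs2 i x y : (1 <= i)%N -> lcs L i x -> lcs L 2 y ->
  lcs L i.+2 (lie x y).
Proof.
case: i => // i _ xi; move: y; apply: lspan_min.
  split=> [|a u v uP vP]; first by rewrite lie0r; exact: (lcs_subspace _ _).1.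
  by rewrite lie_linearr; exact: (lcs_subspace _ _).2.
move=> _ [u _ [v _ <-]].
have step w1 w2 : lcs L i.+3 (lie (lie x w1) w2).
  apply: sub_lspan; exists (lie x w1); last by exists w2.
  by apply: sub_lspan; exists x => //; exists w1.
have -> : lie x (lie u v) = lie (lie x u) v - lie (lie x v) u.
  have /eqP := lie_jacobi x u v; rewrite -addrA addr_eq0 => /eqP ->.
  rewrite [lie v (lie x u)]lieC [lie u _]lieC [lie v x]lieC.
  have -> : lie (- lie x v) u = - lie (lie x v) u.
    by rewrite -scaleN1r lieZl scaleN1r.
  by rewrite opprK opprB.
by apply: subspaceB => //; exact: lcs_subspace.
Qed.

Lemma lcs_le i j : (i <= j)%N -> lcs L j `<=` lcs L i.
Proof.
by move=> /subnK <-; elim: (j - i)%N => // d IH x /lcsS; exact: IH.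
Qed.

(** Such an operator on [L] induces a derivation on the quotients by the first
    terms of the lower central series, so derivations of the quotients can be
    handled on [L] itself. *)
Definition derivation_mod (j : nat) (D : L -> L) :=
  linear D /\ forall x y, lcs L j (D (lie x y) - (lie (D x) y + lie x (D y))).

Lemma derivation_is_mod D j : derivation D -> derivation_mod j D.
Proof.
move=> [Dl Dd]; split=> // x y; rewrite Dd subrr.
exact: (lcs_subspace _ _).1.
Qed.

Lemma derivation_mod_lcs j D i x : derivation_mod j D -> (i <= j)%N ->
  lcs L i x -> lcs L i (D x).
Proof.
move=> [Dl Dd]; elim: i x => [|[|i] IH] x // ij.
have S := lcs_subspace L i.+2; move: x; apply: lspan_min.
  split=> [|a u v uP vP]; first by rewrite lin0 //; exact: S.1.
  by rewrite Dl; exact: S.2.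
move=> _ [u ui [v _ <-]].
rewrite -[D _](subrK (lie (D u) v + lie u (D v))).
apply: subspaceD => //; first by apply: lcs_le (Dd u v).
apply: subspaceD => //; apply: sub_lspan.
  by exists (D u); [exact: IH (ltnW ij) ui|exists v].
by exists u => //; exists (D v).
Qed.

(** The terms of the lower central series are spanned by brackets, on which the
    Leibniz rule gains one step from either factor. *)
Lemma derivation_mod_shift j D : derivation_mod j D ->
  (forall x, lcs L 2 (D x)) ->
  forall i x, (1 <= i < j)%N -> lcs L i x -> lcs L i.+1 (D x).
Proof.
move=> [Dl Dd] D2; elim=> [|[|i] IH] x ij; [by []|by move=> _; exact: D2|].
have S := lcs_subspace L i.+3; move: x; apply: lspan_min.
  split=> [|a u v uP vP]; first by rewrite lin0 //; exact: S.1.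
  by rewrite Dl; exact: S.2.
move=> _ [u ui [v _ <-]].
rewrite -[D _](subrK (lie (D u) v + lie u (D v))).
apply: subspaceD => //; first by apply: lcs_le (Dd u v); case/andP: ij.
apply: subspaceD => //; last exact: (@lie_lcs2 i.+1).
apply: sub_lspan; exists (D u); last by exists v.
by apply: IH ui; case/andP: ij => _ /ltnW.
Qed.

Lemma Wproj_lin k : linear (Wproj L k).
Proof.
by move=> a x y; rewrite /Wproj qprojD qprojZ.
Qed.

Lemma Wproj_eq0 k x : Wproj L k x = 0 <-> lcs L k.+1 x.
Proof.
rewrite -[0](lin0 (@Wproj_lin k)); split.
  by move/(qprojP (lcs_ideal L k.+1)); rewrite subr0.
by move=> xk; apply/(qprojP (lcs_ideal L k.+1)); rewrite subr0.
Qed.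

Lemma Wproj_surj k (w : Wquot L k) : exists x, Wproj L k x = w.
Proof. by exists (repr w); exact: qprojK. Qed.

Lemma Wproj_lie k x y : Wproj L k (lie x y) = lie (Wproj L k x) (Wproj L k y).
Proof. exact: qproj_lie. Qed.

Lemma derivation_mod_induced j D k : derivation_mod j D -> (k < j)%N ->
  exists2 E : Wquot L k -> Wquot L k, derivation E &
    E \o Wproj L k = Wproj L k \o D.
Proof.
move=> Dj kj; have [Dl Dd] := Dj.
pose E (w : Wquot L k) := Wproj L k (D (repr w)).
have EP x : E (Wproj L k x) = Wproj L k (D x).
  apply/eqP; rewrite -subr_eq0 -(linB (@Wproj_lin k)) -(linB Dl).
  apply/eqP/Wproj_eq0/(derivation_mod_lcs Dj) => //.
  by apply/Wproj_eq0; rewrite (linB (@Wproj_lin k)) [X in X - _]qprojK subrr.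
exists E; last by apply/funext => x /=.
have EQ (w : Wquot L k) : exists x, Wproj L k x = w by exact: Wproj_surj.
split=> [a u v|u v]; have [[x <-] [y <-]] := (EQ u, EQ v).
  by rewrite -Wproj_lin !EP Dl Wproj_lin.
rewrite -Wproj_lie !EP -!Wproj_lie -(linD (@Wproj_lin k)).
apply/eqP; rewrite -subr_eq0 -(linB (@Wproj_lin k)); apply/eqP/Wproj_eq0.
by apply: lcs_le (Dd x y).
Qed.

Lemma induced_derivation_mod k (E : Wquot L k -> Wquot L k) D :
  linear D -> derivation E -> E \o Wproj L k = Wproj L k \o D ->
  derivation_mod k.+1 D.
Proof.
move=> Dl [El Ed] ED; split=> // x y; apply/Wproj_eq0.
have EP z : Wproj L k (D z) = E (Wproj L k z) by exact: esym (congr1 (@^~ z) ED).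
rewrite (linB (@Wproj_lin k)) (linD (@Wproj_lin k)) !Wproj_lie !EP Wproj_lie Ed.
by rewrite subrr.
Qed.
End LieBasics.

(** * Diagonal derivations *)

Section DiagonalTorus.
Variables (K : fieldType) (L : lieAlgType K) (B : set L).
Hypothesis Bb : is_basis setT B.

Definition diagonal_derivations : set (L -> L) :=
  [set D | derivation D /\ diagonal_in B D].

Lemma diagonal_derivations_torus : torus diagonal_derivations.
Proof.
split=> [|D []//|D E [[Dl _] dD] [[El _] dE]|D [_ dD]]; last by exists B.
- split=> [|a D E [[Dl Dd] dD] [[El Ed] dE]].
    split; last by move=> b _; exists 0; rewrite scale0r.
    split=> [a u v|x y]; first by rewrite scaler0 addr0.
    by rewrite lie0l lie0r addr0.
  split; last first.
    move=> b Bb'; have [[c Dc] [e Ee]] := (dD b Bb', dE b Bb').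
    by exists (a * c + e); rewrite /= scalerDl -scalerA -Dc -Ee.
  split=> [c u v|x y].
    rewrite /= !fctE /= Dl El !scalerDr !scalerA mulrC.
    by rewrite addrACA -!scalerA.
  rewrite /= !fctE /= Dd Ed lie_linearl lie_linearr scalerDr.
  by rewrite addrACA.
- apply: (eq_on_basis Bb) => [a u v|a u v|b Bb'] /=; rewrite ?El ?Dl ?El //.
  have [[c Dc] [e Ee]] := (dD b Bb', dE b Bb').
  by rewrite Dc Ee (linZ Dl) (linZ El) Dc Ee !scalerA mulrC.
Qed.

(** Diagonal operators in a common basis commute, so the diagonal derivations
    already form a torus. *)
Lemma maximal_diagonal_torus T :
  maximal_torus T -> (forall D, T D -> diagonal_in B D) ->
  T = diagonal_derivations.
Proof.
move=> [Tt Tmax] Td; apply/esym/Tmax; first exact: diagonal_derivations_torus.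
move=> D TD; split; last exact: Td.
by case: Tt => _ + _ _; exact.
Qed.
End DiagonalTorus.

(** * Bases compatible with the lower central series *)

Section CompatibleBasis.
Variables (K : fieldType) (N : lieAlgType K) (B : nat -> set N).
Hypothesis Bcompat : compatible_basis B.
Local Notation BB := (\bigcup_(i in [set i | (1 <= i)%N]) B i).
Local Notation pi := (Wproj N).

Lemma compat_lcs i b : (1 <= i)%N -> B i b -> lcs N i b.
Proof. by move=> i1 Bb; have [_ + _ _] := Bcompat.2 i i1; exact. Qed.

Lemma compat_basis_neq0 i b k : (1 <= i <= k)%N -> B i b -> pi k b <> 0.
Proof.
move=> /andP[i1 ik] Bb /Wproj_eq0 bk.
have [_ _ _ [_ Bi _]] := Bcompat.2 i i1.
have b0 : pi i b = 0 by apply/Wproj_eq0; exact: lcs_le bk.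
have : (1 : K) = 0.
  apply: (Bi [:: pi i b] (fun=> 1)) => //.
  - by move=> v; rewrite inE => /eqP ->; exists b.
  - by rewrite big_seq1 b0 scaler0.
  - exact: mem_head.
by move/eqP; rewrite oner_eq0.
Qed.

Lemma compat_basis_eq0 i b k : (k < i)%N -> B i b -> pi k b = 0.
Proof.
move=> ki Bb; apply/Wproj_eq0/(lcs_le ki)/compat_lcs => //.
by case: i ki {Bb}.
Qed.

(** Modulo N^(j+1), the basis vectors of degree above [j] vanish; so the
    coefficients of a relation vanish degree by degree. *)
Lemma basisW_basis k : is_basis setT (@basisW K N B k).
Proof.
have lpi := @Wproj_lin K N.
split=> // [s c us sB s0|w _].
  have /choice[b bP] (v : Wquot N k) : exists b, v \in s ->
      (exists2 i, (1 <= i <= k)%N & B i b) /\ pi k b = v.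
    have [/sB[b [i ik Bb] bv]|vs] := pselect (v \in s); last by exists 0 => /vs.
    by exists b => _; split=> //; exists i.
  have /choice[d dP] (v : Wquot N k) : exists i, v \in s ->
      (1 <= i <= k)%N /\ B i (b v).
    have [vs|vs] := pselect (v \in s); last by exists 0 => /vs.
    by have [[i ik Bb] _] := bP v vs; exists i.
  suff cd j : (j <= k)%N -> forall v, v \in s -> (d v <= j)%N -> c v = 0.
    by move=> v vs; apply: (cd k) => //; have [/andP[]] := dP v vs.
  elim: j => [|j IH] jk v vs dvj.
    by have [/andP[+ _] _] := dP v vs; rewrite leqNgt ltnS dvj.
  have {IH}c0 u : u \in s -> (d u < j.+1)%N -> c u = 0.
    by move=> us'; rewrite ltnS; apply: IH => //; exact: ltnW.
  move: dvj; rewrite leq_eqVlt => /predU1P[dvj|]; last exact: c0.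
  have [_ _ Binj [_ Bi _]] := Bcompat.2 j.+1 isT.
  have sumN : lcs N k.+1 (\sum_(u <- s) c u *: b u).
    apply/Wproj_eq0; rewrite (lin_sum _ _ (lpi k)) -[RHS]s0 !big_seq; apply: eq_bigr => u us'.
    by rewrite (linZ (lpi k)) (bP u us').2.
  have {sumN} : \sum_(u <- [seq u <- s | d u == j.+1]) c u *: pi j.+1 (b u) = 0.
    have /Wproj_eq0 : lcs N j.+2 (\sum_(u <- s) c u *: b u) by exact: lcs_le sumN.
    rewrite (lin_sum _ _ (lpi _)) => h; rewrite -[RHS]h big_filter big_mkcond !big_seq.
    apply: eq_bigr => u us'; rewrite (linZ (lpi _)).
    case: ltngtP => [du|du|//]; first by rewrite c0 ?scale0r.
    by rewrite (compat_basis_eq0 du) ?scaler0 //; exact: (dP u us').2.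
  set s' := seq.filter _ s => sum0.
  have binj : {in s' &, injective (pi j.+1 \o b)}.
    move=> u w; rewrite !mem_filter => /andP[/eqP du us'] /andP[/eqP dw ws'] /= buw.
    rewrite -(bP u us').2 -(bP w ws').2; congr (pi k _).
    apply: Binj => //; apply/mem_set.
      by rewrite -du; exact: (dP u us').2.
    by rewrite -dw; exact: (dP w ws').2.
  have vs' : v \in s' by rewrite mem_filter dvj eqxx.
  have /choice[h hP] w : exists u, w \in map (pi j.+1 \o b) s' ->
      u \in s' /\ (pi j.+1 \o b) u = w.
    have [/mapP[u us' ->]|ws] := boolP (w \in map (pi j.+1 \o b) s').
      by exists u.
    by exists 0.
  have hE u : u \in s' -> h (pi j.+1 (b u)) = u.
    move=> us'; have [|hs hb] := hP (pi j.+1 (b u)).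
      by apply/mapP; exists u.
    exact: binj hb.
  rewrite -(hE v vs').
  apply: (Bi (map (pi j.+1 \o b) s') (c \o h)).
  - by rewrite map_inj_in_uniq // filter_uniq.
  - move=> w /mapP[u + ->]; rewrite mem_filter => /andP[/eqP du us'].
    by exists (b u) => //; rewrite -du; exact: (dP u us').2.
  - rewrite big_map -[RHS]sum0 !big_seq; apply: eq_bigr => u us'.
    by rewrite /= hE.
  by apply/mapP; exists v.
have [x <-] := Wproj_surj w.
have [_ _ /(_ x I)] := Bcompat.1; move: x; apply: lspan_min.
  split=> [|a u v uP vP]; first by rewrite /= (lin0 (lpi k)); exact: (lspan_subspace _).1.
  by rewrite /= lpi; exact: (lspan_subspace _).2.
move=> b [i i1 Bb]; have [ik|ki] := leqP i k.
  by apply: sub_lspan; exists b => //; exists i => //=; rewrite ik andbT.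
by rewrite /= (compat_basis_eq0 ki Bb); exact: (lspan_subspace _).1.
Qed.

(** The lift is a derivation only modulo N^(k+1)
    ([induced_derivation_mod]), which is what the degree argument needs. *)
Lemma diagonal_lift k E : diagonal_derivations (@basisW K N B k) E ->
  exists D, [/\ linear D, diagonal_in BB D & E \o pi k = pi k \o D].
Proof.
move=> [[El _] Ed].
have /choice[a aP] b : exists a : K, BB b -> E (pi k b) = pi k (a *: b).
  have [[i i1 Bb]|nb] := pselect (BB b); last by exists 0.
  have [ik|ki] := leqP i k.
    have [|a Ea] := Ed (pi k b); last by exists a; rewrite (linZ (@Wproj_lin _ _ k)).
    by exists b => //; exists i => //=; rewrite ik andbT.
  by exists 0 => _; rewrite (compat_basis_eq0 ki Bb) scale0r !lin0 //; exact: Wproj_lin.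
have [D Dl DE] := basis_extension (fun b => a b *: b) Bcompat.1.
exists D; split=> // [b Bb|]; first by exists (a b); exact: DE.
apply: (eq_on_basis Bcompat.1) => [c u v|c u v|b Bb] /=.
- by rewrite Wproj_lin El.
- by rewrite Dl Wproj_lin.
by rewrite DE // aP.
Qed.

Lemma diagonal_induced k D j : derivation_mod j D -> (k < j)%N ->
  diagonal_in BB D ->
  exists2 E, diagonal_derivations (@basisW K N B k) E & E \o pi k = pi k \o D.
Proof.
move=> Dj kj Dd; have [E Eder ED] := derivation_mod_induced Dj kj.
exists E => //; split=> // _ [b [i /andP[i1 ik] Bb] <-].
have [|a Da] := Dd b; first by exists i.
exists a; rewrite -[E _]/((E \o pi k) b) ED /= Da.
by rewrite (linZ (@Wproj_lin _ _ k)).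
Qed.

(** If the weights on [B 1] vanish, a lift maps N^i to N^(i+1) for i <= k; a
    nonzero weight on [B i] would put a basis vector in N^(i+1). *)
Lemma diagonal_derivation_eq0 k E : (1 <= k)%N ->
  diagonal_derivations (@basisW K N B k) E ->
  (forall b, B 1 b -> E (pi k b) = 0) -> E = fun=> 0.
Proof.
move=> k1 Ed E1; have [D [Dl Dd ED]] := diagonal_lift Ed.
have Dmod := induced_derivation_mod Dl Ed.1 ED.
have EP z : E (pi k z) = pi k (D z) by exact: (congr1 (@^~ z) ED).
(* A zero value at [b] in the quotient is a zero weight. *)
have wt0 i b a : (1 <= i <= k)%N -> B i b -> D b = a *: b -> pi k (D b) = 0 -> D b = 0.
  move=> ik Bb -> /eqP; rewrite (linZ (@Wproj_lin _ _ k)) scaler_eq0.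
  by move=> /orP[/eqP->|/eqP/(compat_basis_neq0 ik Bb)//]; rewrite scale0r.
have D2 x : lcs N 2 (D x).
  have [_ _ /(_ x I)] := Bcompat.1; move: x; apply: lspan_min.
    split=> [|a u v uP vP]; first by rewrite lin0 //; exact: (lcs_subspace _ _).1.
    by rewrite Dl; exact: (lcs_subspace _ _).2.
  move=> b BBb; have [a Da] := Dd b BBb; case: BBb => i /= i1 Bb.
  move: i1; rewrite leq_eqVlt => /predU1P[i1|i2].
    rewrite -i1 in Bb; rewrite (wt0 1 b a) -?EP ?E1 //.
    exact: (lcs_subspace N 2).1.
  rewrite /= Da; apply: (subspaceZ _ (lcs_subspace N 2)).
  by apply: (lcs_le i2); apply: compat_lcs => //; exact: ltnW.
apply: (eq_on_basis (basisW_basis k) Ed.1.1) => [a u v|_ [b [i ik Bb] <-]].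
  by rewrite scaler0 addr0.
rewrite EP; have [|a Da] := Dd b; first by exists i => //; case/andP: ik.
have Db : lcs N i.+1 (D b).
  apply: (derivation_mod_shift Dmod D2).
    by rewrite ltnS.
  by apply: compat_lcs => //; case/andP: ik.
have [a0|a0] := eqVneq a 0; first by rewrite Da a0 scale0r lin0 //; exact: Wproj_lin.
have : pi i b = 0.
  apply/Wproj_eq0; rewrite -[b](scalerK a0) -Da.
  by apply: subspaceZ => //; exact: lcs_subspace.
have ii : (1 <= i <= i)%N by rewrite leqnn andbT; case/andP: ik.
by move/(compat_basis_neq0 ii Bb).
Qed.
End CompatibleBasis.

(** * Stabilization of the weights and the limit *)

Section Limit.
Variables (K : fieldType) (N : lieAlgType K) (B : nat -> set N).
Hypothesis Npro : pro_nilpotent N.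
Hypothesis Bcompat : compatible_basis B.
Local Notation BB := (\bigcup_(i in [set i | (1 <= i)%N]) B i).
Local Notation pi := (Wproj N).
Local Notation DW k := (diagonal_derivations (@basisW K N B k)).
Local Notation DN := (diagonal_derivations BB).

Let piZ k := linZ (@Wproj_lin K N k).
Let piB k := linB (@Wproj_lin K N k).
Let pi0 k := lin0 (@Wproj_lin K N k).

Lemma eq0_Wproj k0 x : (forall k, (k0 <= k)%N -> pi k x = 0) -> x = 0.
Proof.
move=> h; have [_ inter _] := Npro.
suff : (\bigcap_(i in [set i | (1 <= i)%N]) lcs N i) x by rewrite inter.
move=> i _; apply: (@lcs_le _ _ i (maxn k0 i).+1); first by rewrite leqW ?leq_maxr.
by apply/Wproj_eq0/h/leq_maxl.
Qed.

Lemma eq_Wproj k0 x y : (forall k, (k0 <= k)%N -> pi k x = pi k y) -> x = y.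
Proof.
move=> h; apply/eqP; rewrite -subr_eq0; apply/eqP/(@eq0_Wproj k0) => k kk.
by rewrite piB h ?subrr.
Qed.

Lemma diagonal_derivation_inj k E E' : (1 <= k)%N -> DW k E -> DW k E' ->
  (forall b, B 1 b -> E (pi k b) = E' (pi k b)) -> E = E'.
Proof.
move=> k1 dE dE' EE'.
have [DWs _ _ _] := diagonal_derivations_torus (basisW_basis Bcompat k).
have : E - E' = fun=> 0.
  apply: (diagonal_derivation_eq0 Bcompat k1); first exact: subspaceB.
  by move=> b Bb; rewrite !fctE EE' ?subrr.
move=> EE0; apply/funext => w; apply/eqP; rewrite -subr_eq0; apply/eqP.
exact: (congr1 (@^~ w) EE0).
Qed.

Lemma lift_weight k E D i b a : (1 <= i <= k)%N -> B i b ->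
  diagonal_in BB D -> E \o pi k = pi k \o D ->
  E (pi k b) = a *: pi k b -> D b = a *: b.
Proof.
move=> ik Bb Dd ED Ea; have [|c Dc] := Dd b; first by exists i => //; case/andP: ik.
rewrite Dc; congr (_ *: _); apply/eqP; rewrite -subr_eq0.
have : (c - a) *: pi k b = 0.
  rewrite scalerBl -Ea -piZ -Dc; have := congr1 (@^~ b) ED => /= ->.
  by rewrite subrr.
move/eqP; rewrite scaler_eq0 => /orP[//|/eqP].
by move/(compat_basis_neq0 Bcompat ik Bb).
Qed.

(** Both derivations are induced by the same operator on N, which carries the
    comparison of their weights. *)
Lemma diagonal_descend k j E : (j <= k)%N -> DW k E ->
  exists D, exists2 E', DW j E' &
    [/\ linear D, diagonal_in BB D, E \o pi k = pi k \o D &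
        E' \o pi j = pi j \o D].
Proof.
move=> jk dE; have [D [Dl Dd ED]] := diagonal_lift Bcompat dE.
have Dmod := induced_derivation_mod Dl dE.1 ED.
have [//|E' dE' E'D] := diagonal_induced Dmod _ Dd (k := j).
by exists D, E'.
Qed.

Lemma descend_weight k j E E' D b a : (1 <= k)%N -> B 1 b ->
  diagonal_in BB D -> E \o pi k = pi k \o D -> E' \o pi j = pi j \o D ->
  E (pi k b) = a *: pi k b -> E' (pi j b) = a *: pi j b.
Proof.
move=> k1 Bb Dd ED E'D Ea; have := congr1 (@^~ b) E'D => /= ->.
by rewrite (@lift_weight k E D 1 b a) // piZ.
Qed.

Lemma diagonal_weight k E b : DW k E -> (1 <= k)%N -> B 1 b ->
  exists a, E (pi k b) = a *: pi k b.
Proof. by move=> dE k1 Bb; apply: dE.2; exists b => //; exists 1. Qed.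

(** The weights on the finitely many generators form a decreasing chain of
    subspaces of a finite-dimensional space. *)
Lemma weights_stabilize : exists2 k0, (1 <= k0)%N &
  forall k j E, (k0 <= k)%N -> (k0 <= j)%N -> DW k E ->
  exists2 E', DW j E' & forall b a, B 1 b -> E (pi k b) = a *: pi k b ->
    E' (pi j b) = a *: pi j b.
Proof.
have [/finite_seqP[s sB] _ _ _] := Bcompat.2 1 isT.
pose U k : set 'rV[K]_(size s) := [set a : 'rV_(size s) | exists2 E, DW k.+1 E &
  forall i : 'I_(size s), E (pi k.+1 s`_i) = a 0 i *: pi k.+1 s`_i].
have sB1 (i : 'I_(size s)) : B 1 s`_i by rewrite sB /=; exact: mem_nth.
have Usub k : subspace (U k).
  have [[DW0 DWP] _ _ _] := diagonal_derivations_torus (basisW_basis Bcompat k.+1).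
  split; first by exists 0 => // i; rewrite mxE scale0r.
  move=> c a a' [E dE Ea] [E' dE' Ea']; exists (c *: E + E'); first exact: DWP.
  by move=> i; rewrite !fctE Ea Ea' !mxE scalerDl scalerA.
have Udec k : U k.+1 `<=` U k.
  move=> a [E dE Ea].
  have [D [E' dE' [Dl Dd ED E'D]]] := diagonal_descend (leqnSn k.+1) dE.
  exists E' => // i.
  exact: (descend_weight _ (sB1 i) Dd ED E'D (Ea i)).
have [k0 k0P] := decreasing_subspaces_stable Usub Udec.
exists k0.+1 => // -[|k] [|j] // E k0k k0j dE.
have /choice[a aP] (i : 'I_(size s)) := diagonal_weight dE isT (sB1 i).
have : U k (\row_i a i) by exists E => // i; rewrite mxE aP.
rewrite (k0P k) // -(k0P j) // => -[E' dE' E'a]; exists E' => // b c Bb Ec.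
have : b \in s by rewrite sB in Bb.
move=> /(nthP 0)[i si sib].
have := E'a (Ordinal si); have := aP (Ordinal si); rewrite mxE /= sib Ec => h ->.
congr (_ *: _); apply/esym/eqP; rewrite -subr_eq0.
move/eqP: h; rewrite -subr_eq0 -scalerBl scaler_eq0 => /orP[//|/eqP].
by move/(compat_basis_neq0 Bcompat (isT : (1 <= 1 <= k.+1)%N) Bb).
Qed.
(** An operator with values in N^(k+1) has weight 0 on [B 1], since [B 1] is
    independent modulo N^2; so it vanishes in every quotient. *)
Lemma diagonal_derivation_Wproj_inj k D : (1 <= k)%N -> DN D ->
  (forall x, pi k (D x) = 0) -> D = fun=> 0.
Proof.
move=> k1 dD Dk0.
have D1 b : B 1 b -> D b = 0.
  move=> Bb; have [|a Da] := dD.2 b; first by exists 1.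
  have := Dk0 b; rewrite Da piZ => /eqP; rewrite scaler_eq0.
  have k11 : (1 <= 1 <= k)%N by rewrite k1.
  by move=> /orP[/eqP->|/eqP/(compat_basis_neq0 Bcompat k11 Bb)//]; rewrite scale0r.
apply/funext => x; apply: (eq0_Wproj (k0 := 1)) => j j1.
have [E dE ED] := diagonal_induced (derivation_is_mod j.+1 dD.1) (ltnSn j) dD.2.
have := congr1 (@^~ x) ED; rewrite /= => <-.
rewrite (diagonal_derivation_eq0 Bcompat j1 dE) // => b Bb.
by have := congr1 (@^~ b) ED; rewrite /= D1 // pi0.
Qed.

(** Each basis vector gets its weight from a sufficiently late quotient. Later
    quotients give the same weight, since the derivations chosen at different
    levels have the same weights on [B 1] and so induce one another. *)
Lemma diagonal_extend k0 : (1 <= k0)%N ->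
    (forall k j E, (k0 <= k)%N -> (k0 <= j)%N -> DW k E ->
      exists2 E', DW j E' & forall b a, B 1 b -> E (pi k b) = a *: pi k b ->
        E' (pi j b) = a *: pi j b) ->
  forall k E, (k0 <= k)%N -> DW k E ->
  exists2 D, DN D & E \o pi k = pi k \o D.
Proof.
move=> k01 stab k E k0k dE.
have exE j : exists E', (k0 <= j)%N -> DW j E' /\
    forall b a, B 1 b -> E (pi k b) = a *: pi k b -> E' (pi j b) = a *: pi j b.
  have [k0j|k0j] := leqP k0 j; last by exists (fun=> 0).
  by have [E' dE' E'P] := stab k j E k0k k0j dE; exists E'.
pose Ej j := sval (cid (exE j)).
have EjP j : (k0 <= j)%N -> DW j (Ej j) /\
    forall b a, B 1 b -> E (pi k b) = a *: pi k b -> Ej j (pi j b) = a *: pi j b.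
  exact: svalP (cid (exE j)).
have /choice[Dj DjP] j : exists D, (k0 <= j)%N ->
    [/\ linear D, diagonal_in BB D & Ej j \o pi j = pi j \o D].
  have [k0j|k0j] := leqP k0 j; last by exists (fun=> 0).
  by have [D ?] := diagonal_lift Bcompat (EjP j k0j).1; exists D.
have k1 : (1 <= k)%N by exact: leq_trans k0k.
have EjE j J D : (k0 <= j)%N -> (k0 <= J)%N -> (j <= J)%N -> linear D ->
    diagonal_in BB D -> Ej J \o pi J = pi J \o D -> Ej j \o pi j = pi j \o D.
  move=> k0j k0J jJ Dl Dd ED.
  have Dmod := induced_derivation_mod Dl (EjP J k0J).1.1 ED.
  have [//|E' dE' E'D] := diagonal_induced Dmod _ Dd (k := j).
  suff -> : Ej j = E' by [].
  have j1 : (1 <= j)%N by exact: leq_trans k0j.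
  have J1 : (1 <= J)%N by exact: leq_trans k0J.
  apply: (diagonal_derivation_inj j1 (EjP j k0j).1 dE') => b Bb.
  have [a Ea] := diagonal_weight dE k1 Bb.
  rewrite ((EjP j k0j).2 _ _ Bb Ea).
  by rewrite (descend_weight J1 Bb Dd ED E'D ((EjP J k0J).2 _ _ Bb Ea)).
have /choice[idx idxP] b : exists i, BB b -> (1 <= i)%N /\ B i b.
  have [[i i1 Bb]|nb] := pselect (BB b); last by exists 0.
  by exists i.
have [D Dl DE] := basis_extension (fun b => Dj (maxn k0 (idx b)) b) Bcompat.1.
have ED j : (k0 <= j)%N -> Ej j \o pi j = pi j \o D.
  move=> k0j; have Ejl := (EjP j k0j).1.1.1.
  apply: (eq_on_basis Bcompat.1) => [c u v|c u v|b Bb] /=.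
  - by rewrite Wproj_lin Ejl.
  - by rewrite Dl Wproj_lin.
  rewrite DE //; set J := maxn _ _; have [i1 ib] := idxP b Bb.
  have k0J : (k0 <= J)%N by exact: leq_maxl.
  have [DJl DJd EDJ] := DjP J k0J.
  have [jJ|Jj] := leqP j J.
    by have := congr1 (@^~ b) (EjE _ _ _ k0j k0J jJ DJl DJd EDJ).
  have [Djl Djd EDj] := DjP j k0j.
  have EJ := EjE _ _ _ k0J k0j (ltnW Jj) Djl Djd EDj.
  have [c Dc] := Djd b Bb.
  have iJ : (1 <= idx b <= J)%N by rewrite i1 leq_maxr.
  rewrite (@lift_weight J (Ej J) (Dj J) (idx b) b c) //.
    by rewrite -Dc; exact: (congr1 (@^~ b) EDj).
  by have := congr1 (@^~ b) EJ => /= ->; rewrite Dc piZ.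
exists D.
  split; last first.
    by move=> b Bb; rewrite DE //; have [_ DJd _] := DjP _ (leq_maxl k0 (idx b)); exact: DJd.
  split=> // x y; apply: (eq_Wproj (k0 := k0)) => j k0j.
  have [_ /(_ x y)] := induced_derivation_mod Dl (EjP j k0j).1.1 (ED j k0j).
  by move=> /Wproj_eq0; rewrite piB => /eqP; rewrite subr_eq0 => /eqP.
rewrite -(ED k k0k); congr (_ \o _).
apply: (diagonal_derivation_inj k1 dE (EjP k k0k).1) => b Bb.
by have [a Ea] := diagonal_weight dE k1 Bb; rewrite Ea ((EjP k k0k).2 _ _ Bb Ea).
Qed.
End Limit.

Section ToralData.
Variables (K : fieldType) (N : lieAlgType K).
Variables (T : set (N -> N)) (B : nat -> set N).
Variable Tk : forall k, set (Wquot N k -> Wquot N k).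
Hypothesis Npro : pro_nilpotent N.
Hypothesis TB : toral_data T B Tk.
Local Notation BB := (\bigcup_(i in [set i | (1 <= i)%N]) B i).
Local Notation pi := (Wproj N).

Lemma toral_dataE : T = diagonal_derivations BB.
Proof.
have [Tm Bc Td _] := TB; exact: (maximal_diagonal_torus Bc.1).
Qed.

Lemma toral_data_kE k : (1 <= k)%N ->
  @Tk k = diagonal_derivations (@basisW K N B k).
Proof.
have [_ Bc _ /(_ k) h] := TB => /h[Tkm Tkd].
exact: (maximal_diagonal_torus (basisW_basis Bc k)).
Qed.

Lemma toral_data_inj k D : (1 <= k)%N -> T D -> (forall x, pi k (D x) = 0) ->
  D = fun=> 0.
Proof.
have [_ Bc _ _] := TB.
by rewrite toral_dataE; exact: diagonal_derivation_Wproj_inj.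
Qed.

Lemma lim_tori_toral : lim_tori Tk T.
Proof.
have [[Tt _] Bc _ _] := TB.
have [k0 k01 stab] := weights_stabilize Bc.
exists k0 => //.
have T_induced k D : (k0 <= k)%N -> derivation D -> diagonal_in BB D ->
    exists2 E, Tk E & E \o pi k = pi k \o D.
  move=> k0k Dd Ddiag.
  have [E dE ED] := diagonal_induced (derivation_is_mod k.+1 Dd) (ltnSn k) Ddiag.
  by exists E => //; rewrite toral_data_kE //; exact: leq_trans k0k.
have indT k : (k0 <= k)%N -> induced (pi k) T = @Tk k.
  move=> k0k; have k1 : (1 <= k)%N by exact: leq_trans k0k.
  apply/seteqP; split=> E.
    move=> [D]; rewrite toral_dataE => -[Dd Ddiag] ED.
    have [E' TE' E'D] := T_induced k D k0k Dd Ddiag.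
    suff -> : E = E' by [].
    apply/funext => w; have [x <-] := Wproj_surj w.
    by have := congr1 (@^~ x) ED; have := congr1 (@^~ x) E'D => /= -> ->.
  rewrite toral_data_kE // => dE.
  have [D dD ED] := diagonal_extend Npro Bc k01 stab k0k dE.
  by exists D => //; rewrite toral_dataE.
split=> //.
- move=> k k0k; have k1 : (1 <= k)%N by exact: leq_trans k0k.
  rewrite !toral_data_kE //; apply/seteqP; split=> E.
    move=> [E' dE' EE'].
    have [D [E2 dE2 [Dl Dd E'D E2D]]] := diagonal_descend Bc (leqnSn k) dE'.
    suff -> : E = E2 by [].
    apply/funext => w; have [x <-] := Wproj_surj w.
    have := congr1 (@^~ (pi k.+1 x)) EE'; rewrite /= Wstep_proj => ->.
    have := congr1 (@^~ x) E'D; rewrite /= => ->.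
    by rewrite Wstep_proj; have := congr1 (@^~ x) E2D.
  move=> dE; have [D dD ED] := diagonal_extend Npro Bc k01 stab k0k dE.
  have [E' TE' E'D] := T_induced k.+1 D (leqW k0k) dD.1 dD.2.
  exists E'; first by rewrite toral_data_kE in TE'.
  apply/funext => w; have [x <-] := Wproj_surj w.
  rewrite /= Wstep_proj; have := congr1 (@^~ x) E'D; rewrite /= => ->.
  by rewrite Wstep_proj; exact: (congr1 (@^~ x) ED).
move=> T' [_ T'der _ _] indT'.
have T'T : T' `<=` T.
  move=> D T'D.
  have lift k : (k0 <= k)%N -> exists2 D', T D' & forall x, pi k (D x) = pi k (D' x).
    move=> k0k.
    have [E Eder ED] := derivation_mod_induced (derivation_is_mod k.+1 (T'der D T'D)) (ltnSn k).
    have : induced (pi k) T E by rewrite indT // -indT' //; exists D.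
    move=> [D' TD' ED']; exists D' => // x.
    by have := congr1 (@^~ x) ED; have := congr1 (@^~ x) ED' => /= -> ->.
  have [D' TD' DD'] := lift k0 (leqnn _).
  suff -> : D = D' by [].
  apply/funext => x; apply: (eq_Wproj Npro (k0 := k0)) => k k0k.
  have [D2 TD2 DD2] := lift k k0k; rewrite DD2.
  suff : D' - D2 = fun=> 0.
    move=> h; apply/eqP; rewrite eq_sym -subr_eq0; apply/eqP.
    have := congr1 (@^~ x) h; rewrite !fctE /= => /eqP; rewrite subr_eq0 => /eqP ->.
    by rewrite subrr.
  apply: (@toral_data_inj k0) => //.
    by apply: subspaceB => //; case: Tt.
  move=> z; rewrite !fctE /= (linB (@Wproj_lin _ _ k0)) -DD'.
  apply/eqP; rewrite subr_eq0; apply/eqP.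
  apply/(qprojP (lcs_ideal N k0.+1))/(@lcs_le _ _ _ k.+1) => //.
  exact/(qprojP (lcs_ideal N k.+1))/DD2.
apply/seteqP; split=> // D TD.
have [E ED] : exists E, Tk E /\ E \o pi k0 = pi k0 \o D.
  move: TD; rewrite toral_dataE => -[Dd Ddiag].
  by have [E ? ?] := T_induced k0 D (leqnn _) Dd Ddiag; exists E.
have [D' T'D' ED'] : induced (pi k0) T' E by rewrite indT' //; exact: ED.1.
suff -> : D = D' by [].
apply/eqP; rewrite -subr_eq0; apply/eqP.
apply: (@toral_data_inj k0) => //.
  by apply: subspaceB => //; [case: Tt|exact: T'T].
move=> z; rewrite !fctE /= (linB (@Wproj_lin _ _ k0)).
by have := congr1 (@^~ z) ED.2; have := congr1 (@^~ z) ED' => /= -> ->; rewrite subrr.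
Qed.
End ToralData.

(** * Maximal tori in coordinates *)

Section Transport.
Variables (F : numClosedFieldType) (W : lieAlgType F) (n' : nat).
Local Notation n := n'.+1.
Local Notation M := 'M[F]_n.
Variables (X : 'I_n -> W) (crd : W -> 'rV[F]_n).
Hypothesis crd_lin : linear crd.
Hypothesis crdE : forall w, w = \sum_i crd w 0 i *: X i.
Hypothesis crdK : forall x : 'rV_n, crd (\sum_i x 0 i *: X i) = x.

Let vec (x : 'rV[F]_n) := \sum_i x 0 i *: X i.

Let vecK x : crd (vec x) = x. Proof. exact: crdK. Qed.
Let vec_crd w : vec (crd w) = w. Proof. exact/esym/crdE. Qed.
Let vec_lin : linear vec.
Proof.
move=> a x y; rewrite /vec scaler_sumr -big_split /=; apply: eq_bigr => i _.
by rewrite !mxE scalerDl scalerA.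
Qed.
Let crd_inj : injective crd.
Proof. by move=> u v h; rewrite -[u]vec_crd h vec_crd. Qed.

(** Matrices act on row vectors, so composition is reversed
    ([matrix_of_comp]). *)
Definition matrix_of (E : W -> W) : M := \matrix_i crd (E (X i)).
Definition operator_of (A : M) (w : W) : W := vec (crd w *m A).
Definition coord_lie (x y : 'rV[F]_n) : 'rV[F]_n := crd (lie (vec x) (vec y)).

Let br := coord_lie.

Lemma mul_matrix_of E x : linear E -> x *m matrix_of E = crd (E (vec x)).
Proof.
move=> El; rewrite /vec (lin_sum _ _ El) (lin_sum _ _ crd_lin).
apply/rowP => j; rewrite mxE summxE; apply: eq_bigr => i _.
by rewrite (linZ El) (linZ crd_lin) !mxE.
Qed.

Lemma crd_operator E w : linear E -> crd (E w) = crd w *m matrix_of E.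
Proof. by move=> El; rewrite mul_matrix_of // vec_crd. Qed.

Lemma operator_of_lin A : linear (operator_of A).
Proof.
by move=> a u v; rewrite /operator_of crd_lin mulmxDl -scalemxAl vec_lin.
Qed.

Lemma crd_operator_of A w : crd (operator_of A w) = crd w *m A.
Proof. exact: vecK. Qed.

Lemma matrix_ofK E : linear E -> operator_of (matrix_of E) = E.
Proof.
by move=> El; apply/funext => w; rewrite /operator_of -crd_operator // vec_crd.
Qed.

Lemma operator_ofK A : matrix_of (operator_of A) = A.
Proof.
apply/row_matrixP => i; rewrite !rowE mul_matrix_of; last exact: operator_of_lin.
by rewrite crd_operator_of vecK.
Qed.

Lemma matrix_of_lin : linear matrix_of.
Proof.
move=> a D E; apply/matrixP => i j; rewrite !mxE.
by rewrite -[(a *: D + E) (X i)]/(a *: D (X i) + E (X i)) crd_lin !mxE.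
Qed.

Lemma coord_lie_linl z a x y : br (a *: x + y) z = a *: br x z + br y z.
Proof. by rewrite /br /coord_lie vec_lin lie_linearl crd_lin. Qed.

Lemma coord_lie_linr z a x y : br z (a *: x + y) = a *: br z x + br z y.
Proof. by rewrite /br /coord_lie vec_lin lie_linearr crd_lin. Qed.

Lemma matrix_of_derivation E : derivation E -> mx_derivation br (matrix_of E).
Proof.
move=> [El Ed] x y; rewrite /br /coord_lie -crd_operator // Ed (linD crd_lin).
by rewrite !mul_matrix_of // !vec_crd.
Qed.

Lemma operator_of_derivation A : mx_derivation br A -> derivation (operator_of A).
Proof.
move=> dA; split=> [|u v]; first exact: operator_of_lin.
apply: crd_inj; rewrite crd_operator_of (linD crd_lin).
by have := dA (crd u) (crd v); rewrite /br /coord_lie !vec_crd.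
Qed.

Lemma matrix_of_diagonalizable E : linear E -> Defs.diagonalizable E ->
  mxpoly.diagonalizable (matrix_of E).
Proof.
move=> El [B [_ _ Bs] Bd].
have /choice[a aP] b : exists a : F, B b -> E b = a *: b.
  have [Bb|nb] := pselect (B b); last by exists 0.
  by have [a Ea] := Bd b Bb; exists a.
have /choice[s sP] i : exists s : seq (F * W),
    (forall p, p \in s -> B p.2) /\ X i = \sum_(p <- s) p.1 *: p.2.
  by have [//|s sB ->] := Bs (X i); exists s.
(* The eigenvalues of the finitely many eigenvectors needed to expand the [X i]. *)
pose rs := undup (flatten [seq [seq a p.2 | p <- s i] | i <- enum 'I_n]).
apply/diagonalizableP; exists rs; first exact: undup_uniq.
apply: mxminpoly_min; apply/row_matrixP => i; rewrite row0 rowE.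
have -> : delta_mx 0 i = crd (X i).
  rewrite -[LHS]vecK; congr crd; rewrite /vec (bigD1 i) //= mxE !eqxx scale1r.
  by rewrite big1 ?addr0 // => j /negbTE ji; rewrite mxE ji andbF scale0r.
rewrite (sP i).2 (lin_sum _ _ crd_lin) mulmx_suml; apply: big1_seq => p /= ps.
have Bp := (sP i).1 p ps.
rewrite (linZ crd_lin) -scalemxAl.
suff -> : crd p.2 *m horner_mx (matrix_of E) (\prod_(x <- rs) ('X - x%:P)) = 0.
  by rewrite scaler0.
have : a p.2 \in rs.
  rewrite /rs mem_undup; apply/flattenP; exists [seq a p.2 | p <- s i].
    by apply/mapP; exists i; rewrite ?mem_enum.
  by apply/mapP; exists p.
move=> ars; rewrite (big_rem (a p.2)) //= rmorphM /= -mulmxE mulmxA.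
rewrite rmorphB /= horner_mx_X horner_mx_C mulmxBr mul_mx_scalar.
by rewrite -crd_operator // aP // (linZ crd_lin) subrr mul0mx.
Qed.

Lemma operator_of_diagonalizable A : mxpoly.diagonalizable A ->
  Defs.diagonalizable (operator_of A).
Proof.
move=> /diagonalizable_conj[P Pu [d AE]].
pose e i := vec (row i P).
have eE (c : 'I_n -> F) : \sum_i c i *: e i = vec ((\row_i c i) *m P).
  rewrite mulmx_sum_row (lin_sum _ _ vec_lin); apply: eq_bigr => i _.
  by rewrite (linZ vec_lin) mxE.
have [||| eb einj] := @free_family_basis _ _ setT _ e.
- by [].
- move=> c c0 i; have : (\row_i c i) *m P = 0.
    by rewrite -[LHS]vecK -eE c0 (lin0 crd_lin).
  move=> /(congr1 (mulmx^~ (invmx P))); rewrite mulmxK // mul0mx.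
  by move/rowP/(_ i); rewrite !mxE.
- move=> u _; exists (fun i => (crd u *m invmx P) 0 i); rewrite eE.
  rewrite [\row_i _](_ : _ = crd u *m invmx P); last by apply/rowP => i; rewrite mxE.
  by rewrite mulmxKV // vec_crd.
exists (range e) => // _ [i _ <-]; exists (d 0 i).
apply: crd_inj; rewrite crd_operator_of (linZ crd_lin) vecK AE !mulmxA.
rewrite -row_mul mulmxV // row1 -rowE row_diag_mx -scalemxAl -rowE.
by [].
Qed.

Lemma matrix_of_comp D E : linear D -> linear E ->
  matrix_of (D \o E) = matrix_of E * matrix_of D.
Proof.
move=> Dl El; apply/row_matrixP => i; rewrite row_mul !rowE mul_matrix_of.
  by rewrite /= crd_operator // -mul_matrix_of // mulmxA.
by move=> a u v /=; rewrite El Dl.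
Qed.

(** If a diagonalizable derivation [A] commutes with [T], its operator and [S]
    span a torus, by simultaneous diagonalization of two commuting matrices. *)
Lemma maximal_torus_matrix (S : set (W -> W)) : maximal_torus S ->
  exists2 T : {vspace M}, mx_maximal_torus (mx_derivation br) T &
    forall A, A \in T <-> exists2 E, S E & matrix_of E = A.
Proof.
move=> [[Ss Sder Sc Sd] Smax].
have Sl E : S E -> linear E by move=> /Sder[].
have [T TE] : exists T : {vspace M}, forall A, A \in T <->
    [set A | exists2 E, S E & matrix_of E = A] A.
  apply: subspace_vspace; split.
    by exists 0; [exact: Ss.1|rewrite (lin0 matrix_of_lin)].
  move=> a _ _ [D SD <-] [E SE <-]; exists (a *: D + E); first exact: Ss.2.
  by rewrite matrix_of_lin.
exists T => //; split.
  split=> [A /TE[E /Sder + <-]|A A' /TE[E SE <-] /TE[D SD <-]|A /TE[E SE <-]].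
  - exact: matrix_of_derivation.
  - by rewrite -(matrix_of_comp (Sl _ SD) (Sl _ SE)) -(matrix_of_comp (Sl _ SE) (Sl _ SD)) (Sc D E).
  - by apply: matrix_of_diagonalizable; [exact: Sl|exact: Sd].
move=> A dA diagA cA; apply/TE; exists (operator_of A); last exact: operator_ofK.
pose S' : set (W -> W) := [set G | exists a, exists2 E, S E & G = a *: operator_of A + E].
have AE E : S E -> operator_of A \o E = E \o operator_of A.
  move=> SE; have El := Sl E SE; have Al := operator_of_lin A.
  have : matrix_of (operator_of A \o E) = matrix_of (E \o operator_of A).
    by rewrite (matrix_of_comp Al El) (matrix_of_comp El Al) operator_ofK cA //; apply/TE; exists E.
  move/(congr1 operator_of); rewrite !matrix_ofK //.
    by move=> a u v /=; rewrite Al El.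
  by move=> a u v /=; rewrite El Al.
have S'd G : S' G -> derivation G.
  move=> [a [E SE ->]]; have El := Sl E SE; have dE := Sder E SE.
  rewrite -(matrix_ofK El) -(operator_ofK A).
  have -> : a *: operator_of (matrix_of (operator_of A)) + operator_of (matrix_of E) =
      operator_of (a *: A + matrix_of E).
    rewrite operator_ofK; apply/funext => w; apply: crd_inj.
    rewrite !fctE /= crd_lin !crd_operator_of mulmxDr -scalemxAr.
    by [].
  apply: operator_of_derivation; apply: (mx_derivation_lin coord_lie_linl coord_lie_linr) => //.
  exact: matrix_of_derivation.
have S'S : S' = S.
  apply: Smax; last first.
    by move=> E SE; exists 0, E => //; rewrite scale0r add0r.
  split=> //.
  - split; first by exists 0, 0; [exact: Ss.1|rewrite scale0r addr0].
    move=> c _ _ [a [E SE ->]] [b [D SD ->]]; exists (c * a + b), (c *: E + D).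
      exact: Ss.2.
    by rewrite scalerDr scalerA addrACA -scalerDl.
  - move=> G H S'G S'H; have [Gl _] := S'd G S'G; have [Hl _] := S'd H S'H.
    suff : matrix_of (G \o H) = matrix_of (H \o G).
      move/(congr1 operator_of); rewrite !matrix_ofK //.
        by move=> a u v /=; rewrite Gl Hl.
      by move=> a u v /=; rewrite Hl Gl.
    rewrite (matrix_of_comp Gl Hl) (matrix_of_comp Hl Gl).
    case: S'G S'H => [a [E SE ->]] [b [D SD ->]]; rewrite !matrix_of_lin operator_ofK.
    have cE : A * matrix_of E = matrix_of E * A by apply: cA; apply/TE; exists E.
    have cD : A * matrix_of D = matrix_of D * A by apply: cA; apply/TE; exists D.
    have cDE : matrix_of D * matrix_of E = matrix_of E * matrix_of D.
      by rewrite -(matrix_of_comp (Sl _ SD) (Sl _ SE)) -(matrix_of_comp (Sl _ SE) (Sl _ SD)) (Sc D E).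
    rewrite !mulrDl !mulrDr -!scalerAl -!scalerAr cE cD cDE !scalerA mulrC.
    by rewrite -!addrA; congr (_ + _); rewrite addrCA.
  - move=> G S'G; have [Gl _] := S'd G S'G.
    rewrite -(matrix_ofK Gl); apply: operator_of_diagonalizable.
    case: S'G => [a [E SE ->]]; rewrite matrix_of_lin operator_ofK.
    have cE : A * matrix_of E = matrix_of E * A by apply: cA; apply/TE; exists E.
    have [P Pu PAE] : codiagonalizable [:: A; matrix_of E].
      apply/codiagonalizableP; split=> [C D|C].
        by rewrite !inE => /orP[]/eqP-> /orP[]/eqP->.
      rewrite !inE => /orP[]/eqP-> //.
      by apply: matrix_of_diagonalizable; [exact: Sl|exact: Sd].
    exists P => //; move: PAE => /= /and3P[PA PE _].
    apply/(diagonalizable_forP _ Pu) => i j ij.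
    rewrite mulmxDr mulmxDl -scalemxAr -scalemxAl !mxE.
    have /(diagonalizable_forP _ Pu)/(_ i j ij) := PA; rewrite mxE => ->.
    have /(diagonalizable_forP _ Pu)/(_ i j ij) := PE; rewrite mxE => ->.
    by rewrite mulr0 addr0.
rewrite -S'S; exists 1, 0; first exact: Ss.1.
by rewrite scale1r addr0.
Qed.
End Transport.

(** * Comparison of the dimensions *)

Section ToralDimension.
Variables (F : numClosedFieldType) (N : lieAlgType F).
Hypothesis Npro : pro_nilpotent N.

Section FixedQuotient.
Variables (k n' : nat) (X : 'I_n'.+1 -> Wquot N k) (crd : Wquot N k -> 'rV[F]_n'.+1).
Hypothesis k1 : (1 <= k)%N.
Hypothesis crd_lin : linear crd.
Hypothesis crdE : forall w, w = \sum_i crd w 0 i *: X i.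
Hypothesis crdK : forall x : 'rV_n'.+1, crd (\sum_i x 0 i *: X i) = x.

Lemma toral_basis T B Tk : toral_data T B Tk -> induced (Wproj N k) T = Tk k ->
  exists2 S : {vspace 'M[F]_n'.+1},
    mx_maximal_torus (mx_derivation (coord_lie X crd)) S &
    exists2 BT, is_basis T BT & (BT #= `I_(\dim S))%card.
Proof.
move=> TB TkE; have [Tmax _ _ /(_ k k1)[Tkmax _]] := TB.
have [[Ts _ _ _] _] := Tmax.
have [S Smax SE] := maximal_torus_matrix crd_lin crdE crdK Tkmax.
exists S => //.
(* Linear in all maps [D]; on [T] it is passage to the quotient. *)
pose bar (D : N -> N) (w : Wquot N k) := Wproj N k (D (repr w)).
have barE D E : E \o Wproj N k = Wproj N k \o D -> bar D = E.
  move=> ED; apply/funext => w; rewrite /bar.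
  have := congr1 (@^~ (repr w)) ED => /= <-.
  by congr E; exact: qprojK.
have TE D : T D -> exists2 E, Tk k E & E \o Wproj N k = Wproj N k \o D.
  move=> TD; have [_ Bc _ _] := TB.
  have := TD; rewrite (toral_dataE TB) => -[Dd Ddiag].
  have [E dE ED] := diagonal_induced (derivation_is_mod k.+1 Dd) (ltnSn k) Ddiag.
  by exists E => //; rewrite (toral_data_kE TB k1).
apply: (@pullback_basis _ _ _ T (matrix_of X crd \o bar)) => //.
- move=> a D E; rewrite /= -(matrix_of_lin X crd_lin); congr matrix_of.
  by apply/funext => w; rewrite /bar !fctE /= Wproj_lin.
- move=> D TD /= D0; apply: (toral_data_inj Npro TB k1 TD) => x.
  have [E TkE' ED] := TE D TD; have := congr1 (@^~ x) ED => /= <-.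
  have [[_ Eder _ _] _] := Tkmax; have [El _] := Eder E TkE'.
  rewrite (barE _ _ ED) in D0; rewrite -(matrix_ofK crd_lin crdE El) D0.
  by rewrite /operator_of mulmx0 big1 // => i _; rewrite mxE scale0r.
move=> A; rewrite SE; split=> [[E]|[D TD <-]].
  by rewrite -TkE => -[D TD ED] <-; exists D => //=; rewrite (barE _ _ ED).
by have [E TkE' ED] := TE D TD; exists E => //=; rewrite (barE _ _ ED).
Qed.
End FixedQuotient.

Lemma toral_same_dim (T1 T2 : set (N -> N)) (B1 B2 : nat -> set N)
    (Tk1 Tk2 : forall k, set (Wquot N k -> Wquot N k)) :
  toral_data T1 B1 Tk1 -> toral_data T2 B2 Tk2 -> same_dim T1 T2.
Proof.
move=> TB1 TB2.
have [k1 k11 [_ _ ind1 _]] := lim_tori_toral Npro TB1.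
have [k2 k21 [_ _ ind2 _]] := lim_tori_toral Npro TB2.
pose k := maxn k1 k2; have k_gt0 : (1 <= k)%N by rewrite leq_max k11.
have [_ _ /(_ k k_gt0) fin] := Npro.
have [[|n'] [X [crd [crd_lin crdE crdK]]]] := finite_dim_coordinates fin.
  have T0 (T : set (N -> N)) (B : nat -> set N)
      (Tk : forall k, set (Wquot N k -> Wquot N k)) :
      toral_data T B Tk -> is_basis T set0.
    move=> TB; split=> [b []|s c _ s0 _ v /s0 []|D TD].
    have -> : D = fun=> 0; last by exists [::]; rewrite ?big_nil.
    apply: (toral_data_inj Npro TB k_gt0 TD) => x.
    by rewrite [LHS]crdE big_ord0.
  exists set0, set0; split; [exact: T0 TB1|exact: T0 TB2|exact: card_eqxx].
have [S1 m1 [C1 b1 c1]] := toral_basis k_gt0 crd_lin crdE crdK TB1 (ind1 k (leq_maxl _ _)).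
have [S2 m2 [C2 b2 c2]] := toral_basis k_gt0 crd_lin crdE crdK TB2 (ind2 k (leq_maxr _ _)).
have brl := coord_lie_linl X crd_lin.
have brr := coord_lie_linr X crd_lin.
have dim_le S S' := @mx_maximal_torus_dim_le _ _ _ (mx_derivation0 brl brr)
  (mx_derivation_lin brl brr) (mx_derivation_comm brl brr)
  (@mx_derivation_jordan _ _ _ brl brr) S S'.
have dimE : \dim S1 = \dim S2.
  by apply/eqP; rewrite eqn_leq !dim_le //; [exact: m2.1|exact: m1.1].
exists C1, C2; split=> //; apply: card_eq_trans c1 _.
by rewrite dimE; exact: card_esym.
Qed.
End ToralDimension.

Theorem theorem3p2 (R : realType) (N : lieAlgType R[i])
    (N_countable : countable_dim N) (N_pronil : pro_nilpotent N) :
  (forall (T : set (N -> N)) (B : nat -> set N)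
          (Tk : forall k, set (Wquot N k -> Wquot N k)),
      toral_data T B Tk -> lim_tori Tk T) /\
  (forall (T1 T2 : set (N -> N)) (B1 B2 : nat -> set N)
          (Tk1 Tk2 : forall k, set (Wquot N k -> Wquot N k)),
      toral_data T1 B1 Tk1 -> toral_data T2 B2 Tk2 -> same_dim T1 T2).
Proof.
split=> [T B Tk|T1 T2 B1 B2 Tk1 Tk2]; first exact: lim_tori_toral.
exact: toral_same_dim.
Qed.
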